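(* The logic $\mathrm{S2S}+\forall^{=1}_\pi$ is strictly more expressive than $\mathrm{S2S}$: every set definable by an $\mathrm{S2S}$ formula is definable by an $\mathrm{S2S}+\forall^{=1}_\pi$ formula, and there is a set definable by an $\mathrm{S2S}+\forall^{=1}_\pi$ formula that is not definable by any $\mathrm{S2S}$ formula.
   Context: $\mathrm{S2S}$ is monadic second-order logic of the full binary tree $(\{\mathtt{L},\mathtt{R}\}^\ast,\mathrm{succ}_L,\mathrm{succ}_R)$ with $\mathrm{succ}_L=\{(w,w\mathtt{L})\}$, $\mathrm{succ}_R=\{(w,w\mathtt{R})\}$: formulas are built from atoms $\mathrm{succ}_L(x,y)$, $\mathrm{succ}_R(x,y)$, $x\in X$ using $\neg,\vee$, first-order quantification over vertices and second-order quantification over sets of vertices; a formula with free second-order variables defines the set of tuples of sets of vertices satisfying it. A path is a set of vertices containing the root, closed under prefixes, in which every element has exactly one child in the set; the set $\mathcal{P}$ of paths is identified with $\{\mathtt{L},\mathtt{R}\}^\omega$, carrying the uniform product probability measure $\mu_w$. $\mathrm{S2S}+\forall^{=1}_\pi$ adds the quantifier $\forall^{=1}_\pi X.\,\phi$: a tuple $t$ satisfies $\forall^{=1}_\pi X.\,\phi(X,\vec{Y})$ iff $\mu_w(\{p\in\mathcal{P}\mid (p,t)\text{ satisfies }\phi\})=1$. *)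

(* Defs.v *)
From HB Require Import structures.
From mathcomp Require Import all_boot all_order all_algebra.
From mathcomp Require Import archimedean.
From mathcomp Require Import all_classical all_reals all_analysis.
From mathcomp Require Import lra zify.

Set Implicit Arguments.
Unset Strict Implicit.
Unset Printing Implicit Defensive.

Import Order.TTheory GRing.Theory Num.Theory.
Import numFieldNormedType.Exports.

Local Open Scope classical_set_scope.
Local Open Scope ring_scope.

(* A vertex is the word of directions leading to it from the root; the
   children of w are [rcons w dirL] and [rcons w dirR]. *)
Definition dirL : bool := false.
Definition dirR : bool := true.
Definition vertex : Type := seq bool.

Definition is_path (p : set vertex) : Prop :=
  [/\ p [::],
      (forall v w, prefix v w -> p w -> p v) &
      (forall w, p w -> exists! d, p (rcons w d))].

Definition word : Type := nat -> bool.

Definition path_of (b : word) : set vertex := [set w | w = mkseq b (size w)].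

Lemma mkseqS (b : word) n : mkseq b n.+1 = rcons (mkseq b n) (b n).
Proof. by rewrite /mkseq -addn1 iotaD map_cat cats1. Qed.

Lemma path_ofP (b : word) n : path_of b (mkseq b n).
Proof. by rewrite /path_of /= size_mkseq. Qed.

Lemma path_of_rcons (b : word) w d :
  path_of b w -> path_of b (rcons w d) <-> d = b (size w).
Proof.
rewrite /path_of /= => {1}->; rewrite size_rcons mkseqS.
by split=> [/rcons_inj [] |->].
Qed.

(* [path_of] is the identification of infinite words with paths. *)
Lemma path_of_bij : set_bij [set: word] is_path path_of.
Proof.
split.
- move=> b _; split; first by [].
  + move=> v w /prefixP[s ->]; rewrite /path_of /= size_cat /mkseq iotaD map_cat.
    by move=> /eqP; rewrite eqseq_cat ?size_map ?size_iota// => /andP[/eqP].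
  + move=> w pw; exists (b (size w)); split; first exact/path_of_rcons.
    by move=> d /(path_of_rcons _ pw).
- move=> b c _ _ e; apply/funext => n.
  have : mkseq b n.+1 = mkseq c (size (mkseq b n.+1)).
    by have : path_of c (mkseq b n.+1) by rewrite -e; exact: path_ofP.
  by rewrite size_mkseq !mkseqS => /rcons_inj [].
- move=> p [p0 pp pc].
  pose next (w : vertex) := xget dirL [set d | p (rcons w d)].
  pose fix node n := if n is m.+1 then rcons (node m) (next (node m)) else [::].
  pose b : word := fun n => next (node n).
  have pnext w : p w -> p (rcons w (next w)).
    move=> /pc[d [pd _]]; exact: (@xgetPex _ _ [set d | p (rcons w d)] (ex_intro _ d pd)).
  have nodeE n : node n = mkseq b n.
    by elim: n => // n IH; rewrite mkseqS /= /b -IH.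
  have pnode n : p (node n) by elim: n => // n IH; exact: pnext.
  exists b => //; apply/seteqP; split=> [w ->|]; first by rewrite -nodeE.
  apply: last_ind => // w d IH pwd.
  have pw : p w by apply: pp pwd; exact: prefix_rcons.
  have bw := IH pw; apply/(path_of_rcons d bw).
  have ew : w = node (size w) by rewrite nodeE.
  have [d' [_ u]] := pc _ pw.
  by rewrite -(u _ pwd) /b -ew; apply: u; exact: pnext.
Qed.

Definition cylinder (s : seq bool) : set word := [set b | mkseq b (size s) = s].

Notation measurable_word := (g_sigma_algebraType (range cylinder)).

Section uniform_measure.
Variable R : realType.

(* The n-th binary digit of the fractional part of a nonnegative real. *)
Definition digits (x : measurableTypeR R) : measurable_word :=
  (fun n => odd (Num.truncn (2 ^+ n.+1 * (x : R)))) : word.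

Lemma measurable_truncn (P : set nat) n :
  measurable [set x : R | P (Num.truncn (2 ^+ n * x))].
Proof.
pose T k := [set x : R | (Num.truncn (2 ^+ n * x) <= k)%N].
have mT k : measurable (T k).
  have -> : T k = `]-oo, (k.+1%:R / 2 ^+ n)[%classic.
    by apply/seteqP; split=> x; rewrite /T /= in_itv /= truncn_le_nat
      ltr_pdivlMr ?exprn_gt0// mulrC.
  exact: measurable_itv.
rewrite [X in measurable X](_ : _ = \bigcup_(m in P)
  (if m is k.+1 then T m `\` T k else T 0%N)); last first.
  apply/seteqP; split=> x /=.
    move=> Px; exists (Num.truncn (2 ^+ n * x)) => //.
    case e : (Num.truncn (2 ^+ n * x)) => [|k]; rewrite /T /= e //.
    by split; [exact: leqnn | rewrite ltnn].
  move=> [[|k] Pm]; rewrite /T /=.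
    by rewrite leqn0 => /eqP ->.
  move=> [h1 /negP]; rewrite -ltnNge => h2.
  by have -> : Num.truncn (2 ^+ n * x) = k.+1 by apply/eqP; rewrite eqn_leq h1.
apply: bigcup_measurable => -[|k] _ //; exact: measurableD.
Qed.

Lemma cylinder_rcons s d :
  cylinder (rcons s d) = cylinder s `&` [set b : word | b (size s) = d].
Proof.
apply/seteqP; split=> b; rewrite /cylinder /= size_rcons mkseqS.
  by move=> /rcons_inj [].
by move=> [-> ->].
Qed.

Lemma measurable_digits : measurable_fun setT digits.
Proof.
apply: (@measurability _ _ _ measurable_word _ _ (range cylinder) erefl).
move=> _ [_ [s _ <-] <-]; rewrite setTI.
elim/last_ind: s => [|s d IH].
  by rewrite [X in measurable X](_ : _ = setT)//; apply/seteqP; split.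
rewrite cylinder_rcons preimage_setI; apply: measurableI => //.
exact: (measurable_truncn [set m | odd m = d] (size s).+1).
Qed.

HB.instance Definition _ :=
  isMeasurableFun.Build _ _ _ _ digits measurable_digits.

(* The uniform product measure: the law of the binary digits of a uniformly
   distributed real of [0, 1]; see [mu_w_cylinder]. *)
Definition mu_w : probability measurable_word R :=
  distribution (uniform_prob (@ltr01 R)) digits.

Definition word_nat (s : seq bool) : nat := foldl (fun m (d : bool) => m.*2 + d)%N 0%N s.

Lemma word_nat_lt s : (word_nat s < 2 ^ size s)%N.
Proof.
elim/last_ind: s => // s d IH.
rewrite /word_nat foldl_rcons size_rcons expnS -/(word_nat s).
by case: d; lia.
Qed.

Lemma digits_cylinder s (x : R) : 0 <= x < 1 ->
  cylinder s (digits x) <-> Num.truncn (2 ^+ size s * x) = word_nat s.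
Proof.
move=> /andP[x0 x1]; elim/last_ind: s => [|s d IH].
  rewrite /cylinder /= expr0 mul1r; split=> // _.
  by apply/eqP; rewrite truncn_eq// x0.
rewrite cylinder_rcons /= /word_nat foldl_rcons size_rcons -/(word_nat s) /digits.
have E : Num.truncn (2 ^+ size s * x) = (Num.truncn (2 ^+ (size s).+1 * x))./2.
  apply/eqP; rewrite truncn_eq ?mulr_ge0 ?exprn_ge0//.
  set y := 2 ^+ size s * x.
  have -> : 2 ^+ (size s).+1 * x = 2 * y by rewrite exprS mulrA.
  have y0 : 0 <= 2 * y by rewrite !mulr_ge0 ?exprn_ge0.
  move: (Num.truncn _) (truncn_itv y0) => m /andP[h1 h2].
  have e0 : m = (odd m + 2 * m./2)%N by rewrite mul2n odd_double_half.
  have e : m%:R = (odd m)%:R + 2 * (m./2)%:R :> R by rewrite {1}e0 natrD natrM.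
  rewrite e in h1; rewrite -(natr1 m) e in h2; rewrite -(natr1 m./2).
  by case: (odd m) h1 h2 => /= h1 h2; apply/andP; split; lra.
rewrite E in IH; split.
  by move=> [/IH]; set m := Num.truncn _; lia.
set m := Num.truncn _ => e; split; [apply/IH|]; rewrite ?e; move: e; case: d; lia.
Qed.

Lemma mu_w_cylinder s : mu_w (cylinder s) = ((2 ^+ size s)^-1)%:E.
Proof.
rewrite /mu_w /distribution /= /pushforward /uniform_prob integral_uniform_pdf.
set U := digits @^-1` cylinder s.
have mU : measurable U.
  by rewrite -[U]setTI; apply: measurable_digits => //; apply: sub_sigma_algebra; exists s.
pose k : R := (word_nat s)%:R; pose p : R := 2 ^+ size s.
have p0 : 0 < p by rewrite exprn_gt0.
have k0 : 0 <= k by rewrite ler0n.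
have UE : U `&` `[0, 1[ = `[k / p, (k + 1) / p[%classic.
  apply/seteqP; split=> x /=; rewrite !in_itv /=.
    move=> [Ux x01]; have /andP[x0 _] := x01.
    move/(digits_cylinder _ x01)/eqP : Ux; rewrite truncn_eq ?mulr_ge0 ?exprn_ge0//.
    by rewrite -(natr1 (word_nat s)) ler_pdivrMr// ltr_pdivlMr// [x * _]mulrC.
  rewrite ler_pdivrMr// ltr_pdivlMr// => /andP[h1 h2].
  have x0 : 0 <= x by rewrite -(pmulr_lge0 _ p0) (le_trans k0).
  have x01 : 0 <= x < 1.
    rewrite x0 /= -(ltr_pM2r p0) mul1r (lt_le_trans h2)//.
    by rewrite /k (natr1 (word_nat s)) /p -natrX ler_nat word_nat_lt.
  split=> //; apply/(digits_cylinder _ x01)/eqP.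
  by rewrite truncn_eq ?mulr_ge0 ?exprn_ge0// -(natr1 (word_nat s)) [_ * x]mulrC h1 h2.
have -> : U `&` `[0, 1] = (U `&` `[0, 1[) `|` (U `&` [set 1]).
  rewrite -setIUr; congr (_ `&` _); apply/seteqP; split=> x /=; rewrite !in_itv /=.
    by case/andP => -> /=; rewrite le_eqVlt => /orP[/eqP|]; [right|left].
  by case=> [/andP[-> /ltW]//|->]; rewrite ler01 lexx.
rewrite (eq_integral (cst 1%E)); last first.
  move=> x; rewrite inE /= !in_itv /= /uniform_pdf.
  by case=> [[_ /andP[-> /ltW ->]]|[_ ->]]; rewrite ?ler01 ?lexx /= subr0 invr1.
have mI : measurable (U `&` `[0, 1[) by apply: measurableI.
have m1 : measurable (U `&` [set 1]) by apply: measurableI.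
rewrite integral_cst; last exact: measurableU.
rewrite mul1e measureU0//; last first.
  by apply: (subset_measure0 _ _ (@subIsetr _ _ _)) => //; exact: lebesgue_measure_set1.
rewrite UE; apply: etrans (lebesgue_measure_itv `[k / p, (k + 1) / p[) _.
rewrite /= lte_fin ltr_pM2r ?invr_gt0// ltrDl ltr01.
by rewrite -EFinD -mulrBl addrAC subrr add0r mul1r.
Qed.

(* mu_w (A) = 1 for a set A of paths, transported along [path_of].  Measures
   of the library take junk values outside the sigma-algebra, so measurability
   is part of the condition, for the completion of mu_w: containing a
   measurable set of measure 1 is being completion-measurable of measure 1. *)
Definition path_measure_one (A : set (set vertex)) : Prop :=
  exists B : set measurable_word,
    [/\ measurable B, B `<=` path_of @^-1` A & mu_w B = 1%E].

End uniform_measure.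

(* First-order and second-order variables are two separate copies of nat. *)
Inductive formula : Type :=
| SuccL (x y : nat)
| SuccR (x y : nat)
| Mem (x X : nat)
| Neg (phi : formula)
| Or (phi psi : formula)
| All1 (x : nat) (phi : formula)
| All2 (X : nat) (phi : formula)
| AllPath1 (X : nat) (phi : formula).

Fixpoint is_S2S (phi : formula) : bool :=
  match phi with
  | SuccL _ _ | SuccR _ _ | Mem _ _ => true
  | Neg phi | All1 _ phi | All2 _ phi => is_S2S phi
  | Or phi psi => is_S2S phi && is_S2S psi
  | AllPath1 _ _ => false
  end.

Fixpoint fv1 (phi : formula) : seq nat :=
  match phi with
  | SuccL x y | SuccR x y => [:: x; y]
  | Mem x _ => [:: x]
  | Neg phi | All2 _ phi | AllPath1 _ phi => fv1 phi
  | Or phi psi => fv1 phi ++ fv1 psi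
  | All1 x phi => [seq y <- fv1 phi | y != x]
  end.

Fixpoint fv2 (phi : formula) : seq nat :=
  match phi with
  | SuccL _ _ | SuccR _ _ => [::]
  | Mem _ X => [:: X]
  | Neg phi | All1 _ phi => fv2 phi
  | Or phi psi => fv2 phi ++ fv2 psi
  | All2 X phi | AllPath1 X phi => [seq Y <- fv2 phi | Y != X]
  end.

Fixpoint sat (R : realType) (phi : formula)
    (e1 : nat -> vertex) (e2 : nat -> set vertex) : Prop :=
  match phi with
  | SuccL x y => e1 y = rcons (e1 x) dirL
  | SuccR x y => e1 y = rcons (e1 x) dirR
  | Mem x X => e2 X (e1 x)
  | Neg phi => ~ sat R phi e1 e2
  | Or phi psi => sat R phi e1 e2 \/ sat R psi e1 e2
  | All1 x phi => forall v : vertex, sat R phi [eta e1 with x |-> v] e2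
  | All2 X phi => forall A : set vertex, sat R phi e1 [eta e2 with X |-> A]
  | AllPath1 X phi =>
      path_measure_one R
        [set p | is_path p /\ sat R phi e1 [eta e2 with X |-> p]]
  end.

Lemma eq_sat (R : realType) phi e1 e2 e1' e2' :
    {in fv1 phi, e1 =1 e1'} -> {in fv2 phi, e2 =1 e2'} ->
  sat R phi e1 e2 <-> sat R phi e1' e2'.
Proof.
have upd (T : Type) (s : seq nat) (e e' : nat -> T) x v :
    {in [seq y <- s | y != x], e =1 e'} ->
    {in s, [eta e with x |-> v] =1 [eta e' with x |-> v]}.
  move=> h y ys /=; case: eqVneq => // yx.
  by apply: h; rewrite mem_filter yx.
elim: phi e1 e2 e1' e2' =>
    [x y|x y|x X|phi IH|phi IH psi IH'|x phi IH|X phi IH|X phi IH]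
    e1 e2 e1' e2' h1 h2 /=.
- by rewrite !h1 ?inE ?eqxx ?orbT.
- by rewrite !h1 ?inE ?eqxx ?orbT.
- by rewrite !(h1, h2) ?inE.
- by have [h h'] := IH _ _ _ _ h1 h2; split; apply: contra_not.
- have [|//|a b] := IH e1 e2 e1' e2'.
  + by move=> y yP; apply: h1; rewrite mem_cat yP.
  + by move=> y yP; apply: h2; rewrite mem_cat yP.
  have [|//|c d] := IH' e1 e2 e1' e2'.
  + by move=> y yP; apply: h1; rewrite mem_cat yP orbT.
  + by move=> y yP; apply: h2; rewrite mem_cat yP orbT.
  by split=> -[]; tauto.
- have H v := IH [eta e1 with x |-> v] e2 [eta e1' with x |-> v] e2'
    (upd _ _ _ _ _ _ h1) h2.
  by split=> h v; apply/H; exact: h.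
- have H A := IH e1 [eta e2 with X |-> A] e1' [eta e2' with X |-> A]
    h1 (upd _ _ _ _ _ _ h2).
  by split=> h A; apply/H; exact: h.
- have H A := IH e1 [eta e2 with X |-> A] e1' [eta e2' with X |-> A]
    h1 (upd _ _ _ _ _ _ h2).
  rewrite (_ : mkset _ = [set p | is_path p /\ sat R phi e1' [eta e2' with X |-> p]]) //.
  by apply/seteqP; split=> p [pp h]; split=> //; apply/H; exact: h.
Qed.

(* The second-order variables 0, ..., n-1 denote the components of t.  The
   values at other variables, and of first-order variables, are immaterial for
   the formulas considered in [defines], by [eq_sat]. *)
Definition tuple_env n (t : 'I_n -> set vertex) (X : nat) : set vertex :=
  if insub X is Some i then t i else set0.

Definition defines (R : realType) (phi : formula) n
    (S : set ('I_n -> set vertex)) : Prop :=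
  [/\ fv1 phi = [::],
      {in fv2 phi, forall X, (X < n)%N} &
      S = [set t | sat R phi (fun=> [::]) (tuple_env t)]].

Definition S2S_definable (R : realType) n (S : set ('I_n -> set vertex)) : Prop :=
  exists phi, is_S2S phi /\ defines R phi S.

Definition S2S_path_definable (R : realType) n (S : set ('I_n -> set vertex)) : Prop :=
  exists phi, defines R phi S.

(* Main.v *)
From HB Require Import structures.
From mathcomp Require Import all_boot all_order all_algebra.
From mathcomp Require Import all_classical all_reals all_analysis.
From mathcomp Require Import ring lra zify.
Require Import Defs.

(* A separating set consists of the dense sets A of vertices (every vertex has a
   descendant in A) such that it is not the case that almost every path meets A.
   It is nonempty, because the words of A can be long enough for the cylinders
   they span to have small total measure.  A regular dense set is uniformly
   dense: from any vertex A is reached within N steps, so a random path avoids A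
   for mN steps with probability at most (1 - 2^-N)^m, and almost every path
   meets A.  By Rabin's theorem a nonempty S2S-definable set contains a regular
   set, so the separating set is not S2S-definable.

   For Rabin's theorem, formulas are translated to nondeterministic tree
   automata with a min-parity condition.  If an automaton rejects a tree, the
   pathfinder has a positional winning strategy in the acceptance game; the
   complement automaton guesses this strategy, and checks along every branch
   that all plays that follow it are lost by the automaton.  This is a property
   of infinite words over the finite monoid of run profiles, checked by a
   deterministic parity automaton.  Positional determinacy of the emptiness game
   produces a regular tree in every nonempty recognizable set. *)

Set Implicit Arguments.
Unset Strict Implicit.
Unset Printing Implicit Defensive.

Import Order.TTheory GRing.Theory Num.Theory.
Import numFieldNormedType.Exports.

Local Open Scope classical_set_scope.

(** * Parity games *)

Definition inf_often (s : nat -> nat) k := forall n, exists2 m, (n <= m)%N & s m = k.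

Definition wins (P : bool) (s : nat -> nat) := exists k,
  [/\ odd k = P, inf_often s k & exists n, forall m, (n <= m)%N -> (k <= s m)%N].

Lemma wins_exclusive s : wins true s -> wins false s -> False.
Proof.
move=> [k [ok ik [n bk]]] [l [ol il [m bl]]].
have [i ni ei] := il n; have [j mj ej] := ik m.
have : k = l by apply/eqP; rewrite eqn_leq -{1}ei bk//= -{1}ej bl.
by move=> e; rewrite -e ok in ol.
Qed.

Lemma wins_shift P s c : wins P (fun n => s (n + c)%N) -> wins P s.
Proof.
move=> [k [ok ik [n bk]]]; exists k; split=> //.
  by move=> m; have [i mi <-] := ik m; exists (i + c)%N => //; exact: leq_trans (leq_addr _ _).
exists (n + c)%N => m h; have -> : m = (m - c + c)%N by lia.
by apply: bk; lia.
Qed.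

Section parity_game.
Variables (V : Type) (F : finType) (f0 : F).
Variables (owner : V -> bool) (next : V -> F -> V) (pr : V -> nat).

Definition play (P : bool) (sg : V -> F) (p : nat -> V) := forall n,
  if owner (p n) == P then p n.+1 = next (p n) (sg (p n))
  else exists f, p n.+1 = next (p n) f.

Definition region (P : bool) (U W : set V) (sg : V -> F) :=
  [/\ W `<=` U,
      (forall v, W v -> owner v = P -> W (next v (sg v))),
      (forall v f, W v -> owner v <> P -> U (next v f) -> W (next v f)) &
      (forall p, (forall n, W (p n)) -> play P sg p -> wins P (pr \o p))].

Definition subarena (U : set V) := forall v, U v -> exists f, U (next v f).

Lemma play_shift P sg p c : play P sg p -> play P sg (fun n => p (n + c)%N).
Proof. by move=> h n; exact: h. Qed.

Lemma play_eq P sg sg' (W : set V) p : (forall n, W (p n)) ->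
  {in W, sg =1 sg'} -> play P sg p -> play P sg' p.
Proof.
move=> Wp e h n; have := h n; case: ifP => // _ ->.
by rewrite e// inE.
Qed.

Lemma region_union P U W W' sg sg' : region P U W sg ->
  W' `<=` U -> (forall v, W' v -> owner v = P -> (W `|` W') (next v (sg' v))) ->
  (forall v f, W' v -> owner v <> P -> U (next v f) -> (W `|` W') (next v f)) ->
  (forall p, (forall n, (W' `\` W) (p n)) -> play P sg' p -> wins P (pr \o p)) ->
  region P U (W `|` W') (fun v => if `[< W v >] then sg v else sg' v).
Proof.
move=> [WU cP cO win] W'U cP' cO' win'; split.
- by move=> v [/WU|/W'U].
- move=> v Wv ov; case: asboolP => Wv'; first by left; exact: cP.
  by case: Wv => // Wv; exact: cP'.
- move=> v f [Wv|Wv] ov Uf; first by left; exact: (cO v).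
  exact: cO'.
- move=> p Wp pl; have [[n Wn]|nW] := pselect (exists n, W (p n)).
    have WU' m : U (p m) by case: (Wp m) => [/WU|/W'U].
    have Wm m : W (p (m + n)%N).
      elim: m => // m IH; rewrite addSn; have := pl (m + n)%N.
      rewrite (asboolT IH); case: eqP => [ov ->|ov [f e]]; first exact: cP.
      by rewrite e; apply: (cO _ _ IH) => //; rewrite -e.
    apply: (@wins_shift _ _ n); apply: win => //.
    apply: (@play_eq _ _ _ W) (play_shift n pl) => // v; rewrite inE => Wv.
    by rewrite asboolT.
  have nWp m : ~ W (p m) by move=> h; apply: nW; exists m.
  have Wp' m : (W' `\` W) (p m) by case: (Wp m) => // Wm; case: (nWp m).
  apply: win' => //; apply: (@play_eq _ _ _ (~` W)) pl => // v.
  by rewrite inE => Wv; rewrite asboolF.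
Qed.

Lemma maximal_region P U : exists W sg, region P U W sg /\
  forall W' sg', region P U W' sg' -> W `<=` W' -> {in W, sg =1 sg'} -> W' `<=` W.
Proof.
pose T := {x : set V * (V -> F) | region P U x.1 x.2}.
pose le (x y : T) := `[< (sval x).1 `<=` (sval y).1 /\
  {in (sval x).1, (sval x).2 =1 (sval y).2} >].
have r0 : region P U set0 (fun=> f0) by split=> // p /(_ 0%N).
have [||A totA|] := @ZL_preorder T (exist _ (set0, fun=> f0) r0) le.
- by move=> x; apply/asboolP; split.
- move=> y x z /asboolP[h1 h2] /asboolP[h3 h4]; apply/asboolP; split.
    exact: subset_trans h3.
  move=> v vx; rewrite h2// h4//; move: vx; rewrite !inE; exact: h1.
- pose W := [set v | exists2 x, A x & (sval x).1 v].
  pose sg v := xget f0 [set f | exists x, [/\ A x, (sval x).1 v & f = (sval x).2 v]].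
  have sgE x v : A x -> (sval x).1 v -> sg v = (sval x).2 v.
    move=> Ax xv; rewrite /sg; case: xgetP => [_ -> [y [Ay yv ->]]|/(_ ((sval x).2 v)) []].
      have [/asboolP[h1 h2]|/asboolP[h1 h2]] := totA _ _ Ax Ay.
        by rewrite h2// inE.
      by rewrite h2// inE.
    by exists x.
  have rW : region P U W sg.
    split.
    - by move=> v [x Ax]; case: (svalP x) => + _ _ _; exact.
    - move=> v [x Ax xv] ov; exists x => //; rewrite (sgE x)//.
      by case: (svalP x) => _ + _ _; exact.
    - move=> v f [x Ax xv] ov Uf; exists x => //.
      by case: (svalP x) => _ _ + _; exact.
    - move=> p Wp pl; have [x Ax xp] := Wp 0%N.
      have [xU cP cO win] := svalP x.
      have xpn n : (sval x).1 (p n).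
        elim: n => // n IH; have := pl n; rewrite (sgE x)//.
        case: eqP => [ov ->|ov [f e]]; first exact: cP.
        rewrite e; apply: cO => //; rewrite -e.
        by have [y _ /(let: And4 yU _ _ _ := svalP y in yU _)] := Wp n.+1.
      apply: win => //; apply: (@play_eq _ _ _ (sval x).1) pl => // v.
      by rewrite inE => xv; exact: sgE.
  exists (exist _ (W, sg) rW) => x Ax; apply/asboolP; split=> /=.
    by move=> v xv; exists x.
  by move=> v; rewrite inE => xv; rewrite (sgE x).
move=> [[W sg] rW] /= mx; exists W, sg; split=> // W' sg' r' WW' e.
have /asboolP[] : le (exist _ (W', sg') r') (exist _ (W, sg) rW); last by [].
by apply: mx; apply/asboolP; split.
Qed.

(* Zielonka's argument; the player [P] favoured by the least priority [k] wins
   outside of a maximal region [W] of the opponent, by attracting the play to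
   priority [k] and playing inductively where this is impossible. *)
Theorem positional_determinacy d k U : subarena U ->
  (forall v, U v -> k <= pr v < k + d)%N ->
  exists W0 W1 sg0 sg1,
    [/\ region false U W0 sg0, region true U W1 sg1 & U `<=` W0 `|` W1].
Proof.
elim: d k U => [|d IH] k U sU prU.
  exists set0, set0, (fun=> f0), (fun=> f0); split.
  - by split=> // p /(_ 0%N).
  - by split=> // p /(_ 0%N).
  - by move=> v /prU; lia.
suff H : exists WP WO sP sO,
    [/\ region (odd k) U WP sP, region (~~ odd k) U WO sO & U `<=` WP `|` WO].
  move: H; case: (odd k) => /= -[WP [WO [sP [sO [rP rO c]]]]].
    by exists WO, WP, sO, sP; split=> //; rewrite setUC.
  by exists WP, WO, sP, sO.
set P := odd k; have [W [sg [rW mW]]] := maximal_region (~~ P) U.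
have neqN v : owner v <> P -> owner v = ~~ P by case: (owner v) (P) => [] [].
have Nneq v : owner v = ~~ P -> owner v <> P by case: (owner v) (P) => [] [].
have ext W' sg' : W' `<=` U ->
    (forall v, W' v -> owner v = ~~ P -> (W `|` W') (next v (sg' v))) ->
    (forall v f, W' v -> owner v <> ~~ P -> U (next v f) -> (W `|` W') (next v f)) ->
    (forall p, (forall n, (W' `\` W) (p n)) -> play (~~ P) sg' p ->
       wins (~~ P) (pr \o p)) -> W' `<=` W.
  move=> h1 h2 h3 h4; have r := region_union rW h1 h2 h3 h4.
  move=> v Wv; apply: (mW _ _ r); [by move=> ? ?; left| |by right].
  by move=> u; rewrite inE => uW; rewrite asboolT.
pose X := U `\` W.
have single v : X v -> (owner v = ~~ P -> exists f, W (next v f)) ->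
    (owner v <> ~~ P -> forall f, U (next v f) -> W (next v f)) -> False.
  move=> [Uv Wv] h1 h2; apply: Wv; apply: (ext [set v]
      (fun u => xget f0 [set f | W (next u f)])) => //.
  - by move=> _ ->.
  - move=> _ -> ov; left; apply: (@xgetPex _ f0 [set f | W (next v f)]); exact: h1.
  - by move=> _ f -> ov Uf; left; exact: h2.
  - move=> p pv /(_ 0%N); have [/= -> nW] := pv 0%N.
    have [/= -> _] := pv 1%N.
    case: eqP => ov.
      move=> e; case: nW => /=; rewrite [X in W X]e.
      apply: (@xgetPex _ f0 [set f | W (next v f)]); exact: h1.
    move=> [f e]; case: nW; rewrite [X in W X]e; apply: h2 => //.
    by rewrite -e.
have XO v f : X v -> owner v <> P -> U (next v f) -> X (next v f).
  move=> Xv ov Uf; split=> // Wf; apply: (single v) => //.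
    by move=> _; exists f.
  by move=> /(contra_not (@neqN v)).
have sX : subarena X.
  move=> v Xv; have [Uv nWv] := Xv; apply: contrapT => nX.
  have nXf f : U (next v f) -> W (next v f).
    by move=> Uf; apply: contrapT => nWf; apply: nX; exists f.
  by apply: (single v) => // ov; have [f Uf] := sU _ Uv; exists f; exact: nXf.
pose N := [set v | X v /\ pr v = k].
pose pre B := [set v | X v /\ if owner v == P then exists2 f, X (next v f) & B (next v f)
                       else forall f, X (next v f) -> B (next v f)].
pose fix A n := if n is m.+1 then A m `|` pre (A m) else N.
have AS n m : (n <= m)%N -> A n `<=` A m.
  move=> /subnK <-; elim: (m - n)%N => // i IHi v /IHi; by left.
have AX n : A n `<=` X by elim: n => [v []|n IHn v [/IHn|[]]].
pose Y := X `\` \bigcup_n A n.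
have nA v n : Y v -> ~ A n v by move=> [_ h] An; apply: h; exists n.
have YX v : Y v -> X v by case.
have YP v f : Y v -> owner v = P -> X (next v f) -> Y (next v f).
  move=> Yv ov Xf; split=> // -[n _ An]; apply: (@nA v n.+1) => //.
  by right; split; [exact: YX|rewrite ov eqxx; exists f].
have sY : subarena Y.
  move=> v Yv; have [ov|ov] := pselect (owner v = P).
    by have [f Xf] := sX _ (YX _ Yv); exists f; exact: YP.
  apply: contrapT => nY.
  have /choice[r rP] f : exists n, X (next v f) -> A n (next v f).
    have [[n An]|nAf] := pselect (exists n, A n (next v f)); first by exists n.
    exists 0%N => Xf; case: nY; exists f; split=> // -[n _ An].
    by apply: nAf; exists n.
  apply: (@nA v (\max_f r f).+1) => //; right; split; first exact: YX.
  case: eqP => // _ f /rP; apply: AS; exact: leq_bigmax.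
have [|W0 [W1 [sg0 [sg1 [r0 r1 cY]]]]] := IH k.+1 Y sY.
  move=> v Yv; have [Uv _] := YX _ Yv; have := prU v Uv.
  have : pr v <> k by move=> e; apply: (@nA v 0%N) => //; split=> //; exact: YX.
  lia.
have [WP [WO [sP [sO [rP rO {}cY]]]]] : exists WP WO sP sO,
    [/\ region P Y WP sP, region (~~ P) Y WO sO & Y `<=` WP `|` WO].
  rewrite /P; case: (odd k) => /=; first by exists W1, W0, sg1, sg0; rewrite setUC.
  by exists W0, W1, sg0, sg1.
have [YO cO1 cO2 wO] := rO.
have WO0 : WO `<=` W.
  apply: (ext _ sO).
  - by move=> v /YO/YX[].
  - by move=> v Wv ov; right; exact: cO1.
  - move=> v f Wv ov Uf; have [Wf|nWf] := pselect (W (next v f)); first by left.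
    right; apply: cO2 => //; apply: YP => //; first exact: YO.
    by apply: contrapT => /neqN.
  - by move=> p h; apply: wO => n; have [] := h n.
have YWP : Y `<=` WP.
  by move=> v Yv; have [//|/WO0] := cY _ Yv; have [_ nWv] := YX _ Yv.
have [_ cP1 cP2 wP] := rP.
pose good v f := X (next v f) /\ forall n, A n.+1 v -> ~ N v -> owner v = P ->
  (forall m, (m <= n)%N -> ~ A m v) -> A n (next v f).
have /choice[sA sAP] v : exists f, X v -> good v f.
  have [Xv|nXv] := pselect (X v); last by exists f0.
  have [[n [An nN ov nm]]|h] := pselect (exists n, [/\ A n.+1 v, ~ N v, owner v = P &
      forall m, (m <= n)%N -> ~ A m v]).
    case: (An) => [Am|]; first by case: (nm n).
    move=> [_]; rewrite ov eqxx => -[f Xf Af]; exists f => _; split=> // m Am _ _ mm.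
    have -> // : m = n; apply/eqP; rewrite eqn_leq.
    have [//|] := leqP m n => /= mn; last by case: (mm n.+1).
    rewrite leqNgt; apply/negP => mn'; by case: (nm m.+1).
  by have [f Xf] := sX _ Xv; exists f => _; split=> // n h1 h2 h3 h4; case: h; exists n.
pose sX' v := if `[< Y v >] then sP v else sA v.
exists X, W, sX', sg; split=> //; last first.
  by move=> v Uv; have [|] := pselect (W v); [right|left].
split.
- by move=> v [].
- move=> v Xv ov; rewrite /sX'; case: asboolP => Yv; last by have [] := sAP v Xv.
  by case: (rP) => WPY _ _ _; apply/YX/WPY/cP1 => //; exact: YWP.
- by move=> v f Xv ov Uf; exact: XO.
- move=> p Xp pl.
  have [iN|] := pselect (forall n, exists2 m, (n <= m)%N & N (p m)).
    exists k; split=> //.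
      by move=> n; have [m nm [_ e]] := iN n; exists m.
    by exists 0%N => m _; have [/prU/andP[]] := Xp m.
  move=> /existsNP[n0 hn0].
  have nN m : (n0 <= m)%N -> ~ N (p m) by move=> h Nm; apply: hn0; exists m.
  have nAm j m : (n0 <= m)%N -> ~ A j (p m).
    elim: j m => [m /nN//|j IHj m nm Aj].
    have AjS : A j (p m.+1); last by apply: (IHj m.+1) => //; exact: leqW.
    have := pl m; case: eqP => ov.
      rewrite /sX' asboolF; last by move=> Yv; exact: (nA _ _ Yv Aj).
      move=> ->; apply: (sAP _ (Xp m)).2 => //; first exact: nN.
      by move=> i ij; move/(AS _ _ ij); exact: IHj.
    case: Aj => [/IHj []//|[_]]; case: eqP => // _ h [f e].
    by rewrite e; apply: h; rewrite -e.
  apply: (@wins_shift _ _ n0).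
  have Yp m : Y (p (m + n0)%N).
    by split=> // -[j _]; apply: nAm; rewrite leq_addl.
  apply: wP; first by move=> m; exact/YWP.
  apply: (@play_eq _ _ _ Y) (play_shift n0 pl) => // v; rewrite inE => Yv.
  by rewrite /sX' asboolT.
Qed.

End parity_game.

(** * Determinization of parity word automata *)

Lemma inf_often_pigeonhole (T : finType) (P : nat -> Prop) (f : nat -> T) :
  (forall n, exists2 m, (n <= m)%N & P m) ->
  exists t, forall n, exists2 m, (n <= m)%N & P m /\ f m = t.
Proof.
move=> iP; apply: contrapT => /forallNP h.
have /choice[b bP] t : exists n, forall m, (n <= m)%N -> P m -> f m <> t.
  have /existsNP[n hn] := h t; exists n => m nm Pm ft.
  by apply: hn; exists m.
have [m bm Pm] := iP (\max_t b t); apply: (bP (f m) m) => //.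
exact: leq_trans (leq_bigmax (f m)) bm.
Qed.

Lemma bounded_liminf (s : nat -> nat) d : (forall n, s n < d)%N ->
  exists k, inf_often s k /\ exists n, forall m, (n <= m)%N -> (k <= s m)%N.
Proof.
elim: d s => [s /(_ 0%N)//|d IH] s sd.
have [is0|/existsNP[n hn]] := pselect (inf_often s 0).
  by exists 0%N; split=> //; exists 0%N.
have s0 m : (n <= m)%N -> (0 < s m)%N.
  by move=> nm; rewrite lt0n; apply/eqP => e; apply: hn; exists m.
have [|k [ik [l bk]]] := IH (fun i => (s (i + n)%N).-1).
  by move=> i; have := sd (i + n)%N; have := s0 (i + n)%N (leq_addl _ _); lia.
exists k.+1; split.
  move=> m; have [i mi <-] := ik m; exists (i + n)%N; first lia.
  by rewrite prednK// s0// leq_addl.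
exists (l + n)%N => m lm; have := bk (m - n)%N; rewrite subnK; last lia.
by have := s0 m; lia.
Qed.

Section determinization.
Variables (S : finType) (one : S) (mul : Monoid.law one) (acc : S -> S -> bool).

Definition segment (h : nat -> S) i j := \big[mul/one]_(i <= l < j) h l.

Lemma segment_cat h i j k : (i <= j)%N -> (j <= k)%N ->
  segment h i k = mul (segment h i j) (segment h j k).
Proof. by move=> ij jk; rewrite /segment (big_cat_nat ij jk). Qed.

Definition factorization (h : nat -> S) (s e : S) := exists J : nat -> nat,
  [/\ (0 < J 0)%N, (forall a, J a < J a.+1)%N, segment h 0 (J 0) = s &
      (forall a, segment h (J a) (J a.+1) = e)].

Definition merges (g : seq S) r' r :=
  segment (nth one g) r' (size g) == segment (nth one g) r (size g).

Definition merge_index (g : seq S) :=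
  find (fun r => has (fun r' => merges g r' r) (iota 0 r)) (iota 0 (size g)).

Definition merge_target (g : seq S) :=
  find (fun r' => merges g r' (merge_index g)) (iota 0 (merge_index g)).

Definition delete (T : Type) (x : T) (s : seq T) r :=
  mkseq (fun i => nth x s (if i < r then i else i.+1)%N) (size s).-1.

Definition merge (g : seq S) r := mkseq (fun i =>
  if (i.+1 < r)%N then nth one g i else
  if i.+1 == r then mul (nth one g i) (nth one g r) else nth one g i.+1) (size g).-1.

(* A state is the list of the values of consecutive blocks of the input read so
   far.  Two block starts with equal products up to the current position will
   remain so for ever, and the later one is then forgotten. *)
Definition compress (g : seq S) (a : S) :=
  let g' := rcons g a in
  if (merge_index g' < size g')%N then merge g' (merge_index g') else g'.

(* If [m] is the least index deleted infinitely often, the starts before [m] are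
   eventually fixed and each deletion at [m] merges into one of them.  Hence some
   pair of values passed to [acc] recurs, and it factors the input. *)
Definition merge_prio (g : seq S) :=
  let r := merge_index g in let r' := merge_target g in
  if (r < size g)%N then
    (r.*2 + ~~ acc (segment (nth one g) 0 r) (segment (nth one g) r' r))%N
  else #|S|.+1.*2.

Lemma merge_indexP g : (merge_index g < size g)%N ->
  [/\ (merge_target g < merge_index g)%N & merges g (merge_target g) (merge_index g)].
Proof.
move=> h; set r := merge_index g in h *.
have : has (fun r' => merges g r' r) (iota 0 r).
  have := @nth_find _ 0%N (fun r => has (fun r' => merges g r' r) (iota 0 r)) (iota 0 (size g)).
  rewrite has_find size_iota => /(_ h); rewrite nth_iota//.
move=> hh; have lt : (merge_target g < r)%N by rewrite -[ltnRHS](size_iota 0) -has_find.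
split=> //; have := nth_find 0%N hh; rewrite nth_iota//.
Qed.

Lemma merge_index_lt g : (#|S| < size g)%N -> (merge_index g < size g)%N.
Proof.
move=> Sg; rewrite -[ltnRHS](size_iota 0) -has_find; apply/negPn/negP => /hasPn h.
suff : uniq [seq segment (nth one g) r (size g) | r <- iota 0 (size g)].
  move=> /card_uniqP; rewrite size_map size_iota => e.
  by move: (max_card [in [seq segment (nth one g) r (size g) | r <- iota 0 (size g)]]);
    rewrite e leqNgt Sg.
rewrite map_inj_in_uniq ?iota_uniq// => r r'.
rewrite !mem_iota !add0n => /= rs rs' e; apply/eqP; rewrite eqn_leq.
apply/andP; split; rewrite leqNgt; apply/negP => lt.
  have /h/hasPn/(_ r') : r \in iota 0 (size g) by rewrite mem_iota.
  by rewrite mem_iota/= lt /merges e eqxx => /(_ isT).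
have /h/hasPn/(_ r) : r' \in iota 0 (size g) by rewrite mem_iota.
by rewrite mem_iota/= lt /merges e eqxx => /(_ isT).
Qed.

Lemma size_compress g a : (size g <= #|S|)%N -> (size (compress g a) <= #|S|)%N.
Proof.
move=> gS; rewrite /compress; case: ifP => [_|/negbT].
  by rewrite size_mkseq size_rcons.
by move=> h; rewrite leqNgt; apply: contra h => /merge_index_lt.
Qed.

Lemma merge_prio_le g a : (size g <= #|S|)%N ->
  (merge_prio (rcons g a) <= #|S|.+1.*2)%N.
Proof.
rewrite /merge_prio size_rcons => gS; case: ifP => // h.
move: (merge_index _) h #|S| gS => r h N gS; case: (acc _ _) => /=; lia.
Qed.

Section run.
Variable h : nat -> S.

Fixpoint state n := if n is m.+1 then compress (state m) (h m) else [::].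

Lemma size_state n : (size (state n) <= #|S|)%N.
Proof. by elim: n => // n IH; exact: size_compress. Qed.

Let reading n := rcons (state n) (h n).
Let idx n := merge_index (reading n).
Let merging n := (idx n < size (reading n))%N.

Fixpoint starts n := if n is m.+1 then
  let p := rcons (starts m) m in if merging m then delete m.+1 p (idx m) else p
  else [::].

Let blocks (p : seq nat) k :=
  mkseq (fun i => segment h (nth k p i) (nth k p i.+1)) (size p).

Lemma nth_delete (T : Type) (x : T) s r i :
  (r < size s)%N -> nth x (delete x s r) i = nth x s (if i < r then i else i.+1)%N.
Proof.
move=> rs; have [si|si] := ltnP i (size s).-1; first by rewrite nth_mkseq.
by rewrite !nth_default ?size_mkseq//; case: ifP => //; lia.
Qed.

Lemma nth_starts_rcons n i : (i <= size (starts n))%N ->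
  nth n.+1 (rcons (starts n) n) i = nth n (starts n) i.
Proof.
rewrite nth_rcons leq_eqVlt => /orP[/eqP->|lt].
  by rewrite ltnn eqxx nth_default.
by rewrite lt; apply: set_nth_default.
Qed.

Lemma idx_gt0 n : merging n -> (0 < idx n)%N.
Proof. by move=> /merge_indexP[+ _]; exact: leq_trans. Qed.

Lemma starts_bound n i : (nth n (starts n) i <= n)%N /\
  ((i < size (starts n))%N -> (nth n (starts n) i < nth n (starts n) i.+1)%N).
Proof.
have rc m : (forall i, (nth m (starts m) i <= m)%N /\
  ((i < size (starts m))%N -> (nth m (starts m) i < nth m (starts m) i.+1)%N)) ->
  forall i, (nth m.+1 (rcons (starts m) m) i <= m.+1)%N /\
    ((i < size (rcons (starts m) m))%N ->
       (nth m.+1 (rcons (starts m) m) i < nth m.+1 (rcons (starts m) m) i.+1)%N).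
  move=> IH j; have [js|js] := ltnP (size (starts m)) j.
    by split; [rewrite nth_default ?size_rcons|rewrite size_rcons ltnS leqNgt js].
  rewrite nth_starts_rcons//; have [b1 b2] := IH j; split; first exact: leqW.
  move=> _; move: js; rewrite leq_eqVlt => /orP[/eqP->|js].
    by rewrite nth_default// nth_default// size_rcons.
  by rewrite nth_starts_rcons//; exact: b2.
elim: n i => [|n IH] i /=; first by rewrite !nth_nil.
case: ifP => mn; last exact: rc.
have rs : (idx n < size (rcons (starts n) n))%N \/ (size (rcons (starts n) n) <= idx n)%N.
  by case: ltnP; auto.
case: rs => [rs|rs]; last first.
  rewrite /delete size_mkseq; have [si|si] := ltnP i (size (rcons (starts n) n)).-1; last first.
    by rewrite nth_default ?size_mkseq.
  rewrite nth_mkseq// (leq_trans _ rs); last lia.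
  have [b1 b2] := rc n IH i; split=> // _.
  have [si'|si'] := ltnP i.+1 (size (rcons (starts n) n)).-1.
    by rewrite nth_mkseq// (leq_trans _ rs); [apply: b2; lia|lia].
  rewrite [X in (_ < X)%N]nth_default ?size_mkseq//.
  by apply: leq_trans (b2 _) (rc n IH i.+1).1; lia.
rewrite /= !nth_delete// size_mkseq; case: ifP => ir.
  have [b1 b2] := rc n IH i; split=> // isz; case: ifP => _; first by apply: b2; lia.
  by apply: ltn_trans (b2 _) ((rc n IH i.+1).2 _); lia.
have -> : (i.+1 < idx n)%N = false by lia.
by have [b1 b2] := rc n IH i.+1; split=> // isz; apply: b2; lia.
Qed.

Lemma segment_blocks p k i j : (forall i, (i < size p)%N -> (nth k p i <= nth k p i.+1)%N) ->
  (i <= j)%N -> (j <= size p)%N ->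
  segment (nth one (blocks p k)) i j = segment h (nth k p i) (nth k p j).
Proof.
move=> mono; elim: j => [|j IH]; first by case: i => // _ _; rewrite /segment !big_geq.
rewrite leq_eqVlt => /orP[/eqP-> _|ij js]; first by rewrite /segment !big_geq.
rewrite (@segment_cat _ _ j)// IH//; last exact: ltnW.
rewrite [X in mul _ X]/segment big_nat1 nth_mkseq// -segment_cat//; last exact: mono.
elim: j ij js {IH} => [|j IH]; first by case: i.
rewrite ltnS leq_eqVlt => /orP[/eqP->//|ij] js.
by apply: leq_trans (IH _ _) _ => //; [exact: ltnW|apply: mono; exact: ltnW].
Qed.

Lemma stateE n : state n = blocks (starts n) n.
Proof.
elim: n => //= n IH.
have szr : size (reading n) = size (rcons (starts n) n).
  by rewrite !size_rcons IH size_mkseq.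
have rE : reading n = blocks (rcons (starts n) n) n.+1.
  rewrite /reading IH; apply: (@eq_from_nth _ one).
    by rewrite size_rcons !size_mkseq size_rcons.
  move=> i; rewrite size_rcons size_mkseq ltnS => is1.
  rewrite nth_mkseq ?size_rcons// nth_starts_rcons// nth_rcons size_mkseq.
  move: is1; rewrite leq_eqVlt => /orP[/eqP->|is1].
    by rewrite ltnn eqxx !nth_default ?size_rcons// /segment big_nat1.
  by rewrite is1 nth_mkseq// nth_starts_rcons.
rewrite /compress -/(reading n) -/(idx n) -/(merging n); case: ifP => [mn|_]; last by [].
have r0 := idx_gt0 mn; have rs : (idx n < size (rcons (starts n) n))%N by rewrite -szr.
apply: (@eq_from_nth _ one); first by rewrite !size_mkseq szr.
rewrite size_mkseq szr => i isz.
rewrite nth_mkseq ?szr// nth_mkseq ?size_mkseq//.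
rewrite !(nth_delete _ _ rs) rE.
have mono j : (j < size (rcons (starts n) n))%N ->
    (nth n.+1 (rcons (starts n) n) j <= nth n.+1 (rcons (starts n) n) j.+1)%N.
  rewrite size_rcons ltnS => js; rewrite nth_starts_rcons//.
  move: js; rewrite leq_eqVlt => /orP[/eqP->|js].
    by rewrite nth_default// nth_default// size_rcons.
  by rewrite nth_starts_rcons//; apply/ltnW/(starts_bound n j).2.
case: ifP => ir; first by rewrite nth_mkseq ?ir ?(ltnW ir)//; lia.
case: eqP => e; last first.
  have -> : (i < idx n)%N = false by lia.
  by rewrite nth_mkseq//; lia.
rewrite -e ltnSn nth_mkseq; last lia.
rewrite nth_mkseq; last lia.
by rewrite -segment_cat//; apply: mono; lia.
Qed.

Lemma starts0 n : nth n (starts n) 0 = 0%N.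
Proof.
elim: n => //= n IH.
have r0 : nth n.+1 (rcons (starts n) n) 0 = 0%N by rewrite nth_starts_rcons.
case: ifP => // mn; rewrite nth_delete ?idx_gt0//.
by move: mn; rewrite /merging !size_rcons stateE size_mkseq.
Qed.

Let prio n := merge_prio (reading n).

Lemma szr n : size (reading n) = (size (starts n)).+1.
Proof. by rewrite size_rcons stateE size_mkseq. Qed.

Lemma merging_inf_often n : exists2 m, (n <= m)%N & merging m.
Proof.
apply: contrapT => hn.
have nm m : (n <= m)%N -> ~~ merging m by move=> h'; apply/negP => mm; apply: hn; exists m.
have sz i : (i <= size (state (i + n)))%N.
  elim: i => // i IH; rewrite addSn /= /compress -/(reading (i + n)) -/(idx _) -/(merging _).
  by rewrite ifN ?nm ?leq_addl// size_rcons.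
by have := size_state (#|S|.+1 + n); rewrite leqNgt (leq_trans _ (sz _)).
Qed.

Lemma segment_reading n i j : (i <= j)%N -> (j <= size (starts n))%N ->
  segment (nth one (reading n)) i j = segment h (nth n (starts n) i) (nth n (starts n) j).
Proof.
move=> ij js; rewrite -segment_blocks//; last first.
  by move=> l ls; apply/ltnW/(starts_bound n l).2.
rewrite -stateE; apply: eq_big_nat => l /andP[_ lj].
by rewrite nth_rcons stateE size_mkseq (leq_trans lj js).
Qed.

Lemma merging_segment n (t := merge_target (reading n)) : merging n ->
  segment h (nth n (starts n) t) n.+1 = segment h (nth n (starts n) (idx n)) n.+1.
Proof.
move=> mn; have [lt /eqP] := merge_indexP mn.
have rs : (idx n <= size (starts n))%N by rewrite -ltnS -szr.
have suf i : (i <= size (starts n))%N ->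
    segment (nth one (reading n)) i (size (reading n)) = segment h (nth n (starts n) i) n.+1.
  move=> isz; rewrite szr (@segment_cat _ _ (size (starts n)))// segment_reading//.
  rewrite [nth n _ (size _)]nth_default// [RHS](@segment_cat _ _ n)//.
    congr (mul _ _); rewrite /segment !big_nat1 nth_rcons.
    by rewrite stateE size_mkseq ltnn eqxx.
  exact: (starts_bound n i).1.
rewrite !suf//; exact: leq_trans (ltnW lt) rs.
Qed.

Theorem determinization_correct b :
  (forall s e, factorization h s e -> acc s e = b) -> wins (~~ b) prio.
Proof.
move=> accb; have [|c [ic [n0 cn0]]] := @bounded_liminf prio #|S|.+1.*2.+1.
  by move=> n; rewrite ltnS; apply: merge_prio_le; exact: size_state.
exists c; split=> //; last by exists n0.
have prioE n : merging n -> prio n = ((idx n).*2 + ~~ acc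
    (segment h 0 (nth n (starts n) (idx n)))
    (segment h (nth n (starts n) (merge_target (reading n))) (nth n (starts n) (idx n))))%N.
  move=> mn; rewrite /prio /merge_prio -/(idx n) -/(merging n) mn.
  have [lt _] := merge_indexP mn.
  have rs : (idx n <= size (starts n))%N by rewrite -ltnS -szr.
  by rewrite !segment_reading ?starts0// ltnW.
have prioN n : ~~ merging n -> prio n = #|S|.+1.*2.
  by rewrite /prio /merge_prio -/(idx n) -/(merging n) => /negbTE ->.
have idxS n : merging n -> (idx n <= #|S|)%N.
  by rewrite /merging size_rcons ltnS => /leq_trans; apply; exact: size_state.
have cS : (c < #|S|.+1.*2)%N.
  have [n nn mn] := merging_inf_often n0.
  apply: leq_ltn_trans (cn0 n nn) _; rewrite prioE//.
  by have := idxS _ mn; case: (acc _ _) => /=; lia.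
set m := c./2.
have event n : prio n = c -> [/\ merging n, idx n = m & odd c = ~~ acc
    (segment h 0 (nth n (starts n) (idx n)))
    (segment h (nth n (starts n) (merge_target (reading n))) (nth n (starts n) (idx n)))].
  move=> e; have mn : merging n.
    by apply/negPn/negP => /prioN; rewrite e; lia.
  by move: e; rewrite prioE// /m => <-; case: (acc _ _) => /=; split => //; lia.
have idxm n : (n0 <= n)%N -> merging n -> (m <= idx n)%N.
  by move=> /cn0 + mn; rewrite prioE// /m; case: (acc _ _) => /=; lia.
have [k0 k0n0 ek0] := ic n0.
have [mk0 ik0 _] := event _ ek0.
have szm n : (k0 <= n)%N -> (m <= size (starts n))%N.
  move=> /subnK <-; elim: (n - k0)%N => [|i IH]; first by rewrite add0n -ik0 -ltnS -szr.
  rewrite addSn /=; case: ifP => mn; last by rewrite size_rcons leqW.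
  rewrite size_mkseq size_rcons //=.
pose q n := nth n (starts n) m.
have stable n i : (k0 <= n)%N -> (i < m)%N -> nth n (starts n) i = nth k0 (starts k0) i.
  move=> /subnK <-; elim: (n - k0)%N => [//|j IH] im.
  have sj : (i <= size (starts (j + k0)))%N.
    by apply: leq_trans (ltnW im) (szm _ _); rewrite leq_addl.
  rewrite addSn /=; case: ifP => mn; last by rewrite nth_starts_rcons// IH.
  have mi : (m <= idx (j + k0))%N by apply: idxm => //; lia.
  rewrite nth_delete; last by rewrite size_rcons -szr.
  by rewrite (leq_trans im mi) nth_starts_rcons// IH.
have qS n : (k0 <= n)%N -> (q n <= q n.+1)%N /\ (prio n = c -> q n < q n.+1)%N.
  move=> kn; rewrite /q /=; have sm := szm n kn; case: ifP => mn; last first.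
    by rewrite nth_starts_rcons//; split=> // /event[]; rewrite mn.
  have mi : (m <= idx n)%N by apply: idxm => //; exact: leq_trans kn.
  have qlt : (idx n = m -> nth n (starts n) m < nth n.+1 (rcons (starts n) n) m.+1)%N.
    move=> e; move: sm; rewrite leq_eqVlt => /orP[/eqP->|sm].
      by rewrite nth_default// nth_default// size_rcons.
    by rewrite nth_starts_rcons//; exact: (starts_bound n m).2.
  rewrite nth_delete; last by rewrite size_rcons -szr.
  move: mi; rewrite leq_eqVlt => /orP[/eqP e|lt].
    by rewrite -e ltnn; split=> // *; [apply/ltnW|]; exact: qlt.
  by rewrite lt nth_starts_rcons//; split=> // /event[_ e]; rewrite e ltnn in lt.
have qmono n n' : (k0 <= n)%N -> (n <= n')%N -> (q n <= q n')%N.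
  move=> kn /subnK <-; elim: (n' - n)%N => // i IH; apply: leq_trans IH _.
  by have [] := qS (i + n)%N; rewrite ?addSn//; lia.
have qinf K : exists2 n, (k0 <= n)%N & (K <= q n)%N.
  elim: K => [|K [n kn Kn]]; first by exists k0.
  have [n' nn' e] := ic n; exists n'.+1; first lia.
  have [_ /(_ e)] := qS n' (leq_trans kn nn'); apply: leq_ltn_trans.
  exact: leq_trans Kn (qmono _ _ kn nn').
have [[t x] tx] := inf_often_pigeonhole
  (fun n => (inord (merge_target (reading n)) : 'I_#|S|.+1,
             segment h (nth n (starts n) (merge_target (reading n))) (q n))) ic.
have txE n : (k0 <= n)%N -> prio n = c -> inord (merge_target (reading n)) = t ->
    [/\ merge_target (reading n) = t, (t < m)%N,
        nth n (starts n) t = nth k0 (starts k0) t & merging n].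
  move=> kn /event[mn im _] <-; have [lt _] := merge_indexP mn.
  rewrite inordK; last by rewrite ltnS (leq_trans (ltnW lt))// idxS.
  have tm : (merge_target (reading n) < m)%N by rewrite -im.
  by split=> //; exact: stable.
set p := nth k0 (starts k0) t in txE.
have /choice[nx nxP] K : exists n, [/\ (k0 <= n)%N, (K < q n)%N & [/\ prio n = c,
    inord (merge_target (reading n)) = t &
    segment h (nth n (starts n) (merge_target (reading n))) (q n) = x]].
  have [n kn Kq] := qinf K.+1; have [n' nn' [e [e1 e2]]] := tx n.
  have kn' := leq_trans kn nn'.
  exists n'; split=> //; exact: leq_trans Kq (qmono _ _ kn nn').
have qle n : (q n <= n)%N := (starts_bound n m).1.
pose kk a := iter a nx (nx 0%N).
have kkP a : [/\ (k0 <= kk a)%N, prio (kk a) = c, nth (kk a) (starts (kk a)) t = p,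
   segment h p (q (kk a)) = x & segment h p (kk a).+1 = segment h (q (kk a)) (kk a).+1].
  have [K ->] : exists K, kk a = nx K by case: a => [|a]; [exists 0%N|exists (kk a)].
  have [h1 h2 [h3 h4 h5]] := nxP K; have [e1 e2 e3 mn] := txE _ h1 h3 h4.
  rewrite -h5 e1 e3; split=> //; have := merging_segment mn.
  by have [_ -> _] := event _ h3; rewrite e1 e3.
have tm : (t < m)%N.
  by have [h1 h2 [h3 h4 h5]] := nxP 0%N; have [] := txE _ h1 h3 h4.
have pq a : (p < q (kk a))%N.
  have [h1 h2 h3 _ _] := kkP a; rewrite -h3 /q.
  have sm := szm _ h1; elim: (m) tm sm => // m' IH; rewrite ltnS leq_eqVlt => /orP[/eqP->|lt].
    exact: (starts_bound _ _).2.
  by move=> ms; apply: ltn_trans (IH lt (ltnW ms)) _; exact: (starts_bound _ _).2.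
have fac : factorization h (segment h 0 (q (nx 0%N))) x.
  exists (fun a => q (kk a)); split=> //.
  - by apply: leq_ltn_trans (pq 0%N).
  - by move=> a; have [_ + _] := nxP (kk a); apply: leq_ltn_trans; exact: qle.
  move=> a; have [_ qa _] := nxP (kk a); rewrite -/(kk a.+1) in qa.
  have [_ _ _ _ e] := kkP a; have [_ _ _ <- _] := kkP a.+1.
  rewrite (@segment_cat _ _ (kk a).+1)//; last exact: leqW (qle _).
  by rewrite -e -segment_cat//; apply/leqW/leq_trans/qle/ltnW/pq.
have [h1 h2 [h3 h4 h5]] := nxP 0%N; have [_ im ->] := event _ h3.
by rewrite im h5 (accb _ _ fac).
Qed.

End run.
End determinization.

Section word_automata.
Variables (Q : finType) (d : nat).

Definition omin (a b : 'I_d.+1) := if (a <= b)%N then a else b.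

Lemma ominA : associative omin.
Proof.
have v a b : val (omin a b) = minn a b by rewrite /omin; case: leqP.
by move=> a b c; apply: val_inj; rewrite !v minnA.
Qed.

(* A triple [(q, q', c)] records a run from [q] to [q'] of least priority [c]. *)
Notation profile := {set Q * Q * 'I_d.+1}.

Definition profile1 : profile := [set z | (z.1.1 == z.1.2) && (z.2 == ord_max)].

Definition profileM (X Y : profile) : profile := [set z | [exists w : Q * 'I_d.+1 * 'I_d.+1,
  [&& (z.1.1, w.1.1, w.1.2) \in X, (w.1.1, z.1.2, w.2) \in Y & z.2 == omin w.1.2 w.2]]].

Lemma profileMP (X Y : profile) (q q' : Q) c : reflect
  (exists r a b, [/\ (q, r, a) \in X, (r, q', b) \in Y & c = omin a b])
  ((q, q', c) \in profileM X Y).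
Proof.
rewrite inE /=; apply: (iffP existsP) => [[[[r a] b] /= /and3P[h1 h2 /eqP]]|[r [a [b [h1 h2 h3]]]]].
  by exists r, a, b.
by exists (r, a, b); rewrite /= h1 h2 h3 eqxx.
Qed.

Lemma profileA : associative profileM.
Proof.
move=> X Y Z; apply/setP => -[[q q'] c]; apply/profileMP/profileMP.
  move=> [r [a [b [h1 /profileMP[r' [a' [b' [h2 h3 ->]]]] ->]]]].
  exists r', (omin a a'), b'; rewrite ominA; split=> //.
  by apply/profileMP; exists r, a, a'.
move=> [r [a [b [/profileMP[r' [a' [b' [h2 h3 ->]]]] h1 ->]]]].
exists r', a', (omin b' b); rewrite ominA; split=> //.
by apply/profileMP; exists r, b', b.
Qed.

Lemma profile1M : left_id profile1 profileM.
Proof.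
move=> X; apply/setP => -[[q q'] c]; apply/profileMP/idP.
  move=> [r [a [b [+ h ->]]]]; rewrite inE /= => /andP[/eqP-> /eqP->].
  rewrite /omin /=; case: leqP => // db.
  have <- // : b = ord_max by apply: val_inj; apply/eqP; rewrite eqn_leq db -ltnS ltn_ord.
move=> h; exists q, ord_max, c; split=> //; first by rewrite inE !eqxx.
rewrite /omin; case: leqP => // dc; apply: val_inj; apply/eqP.
by rewrite eqn_leq dc -ltnS ltn_ord.
Qed.

Lemma profileM1 : right_id profile1 profileM.
Proof.
have om a : omin a ord_max = a by rewrite /omin -ltnS ltn_ord.
move=> X; apply/setP => -[[q q'] c]; apply/profileMP/idP.
  move=> [r [a [b [h + ->]]]]; rewrite inE /= => /andP[/eqP<- /eqP->].
  by rewrite om.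
by move=> h; exists q', c, ord_max; rewrite om; split=> //; rewrite inE !eqxx.
Qed.

HB.instance Definition _ := Monoid.isLaw.Build profile profile1 profileM
  profileA profile1M profileM1.

Definition has_run (P : bool) (I : Q -> Prop) (h : nat -> profile) :=
  exists (q : nat -> Q) (m : nat -> 'I_d.+1),
    [/\ I (q 0%N), (forall n, (q n, q n.+1, m n) \in h n) & wins P m].

Lemma segmentP (h : nat -> profile) i j q0 q1 (c : 'I_d.+1) : (i < j)%N -> reflect
  (exists (q : nat -> Q) (m : nat -> 'I_d.+1), [/\ q i = q0, q j = q1,
     (forall l, (i <= l < j)%N -> (q l, q l.+1, m l) \in h l /\ (c <= m l)%N) &
     exists2 l, (i <= l < j)%N & m l = c])
  ((q0, q1, c) \in segment profileM h i j).
Proof.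
move=> ij; apply: (iffP idP).
  elim: j ij q1 c => // j IH; rewrite ltnS leq_eqVlt => /orP[/eqP<-|ij] q1 c.
    rewrite /segment big_nat1 => h1.
    exists (fun l => if l == i then q0 else q1), (fun=> c); rewrite eqxx.
    split=> //; first by rewrite gtn_eqF.
      move=> l; rewrite ltnS -eqn_leq => /eqP <-; rewrite eqxx gtn_eqF//.
    by exists i; rewrite ?leqnn /=.
  rewrite (@segment_cat _ _ _ _ _ j)//; last exact: ltnW.
  move=> /profileMP[r [a [b [/(IH ij)[q [m [qi qj qm [l lij ml]]]]]]]].
  rewrite /segment big_nat1 => hb cE.
  have cl : (c <= a)%N /\ (c <= b)%N.
    by rewrite cE /omin; case: (leqP a b) => [|/ltnW] h1; rewrite leqnn.
  exists (fun l => if (l <= j)%N then q l else q1), (fun l => if (l < j)%N then m l else b).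
  rewrite (ltnW ij) ltnn; split=> //.
    move=> l'; rewrite ltnS => /andP[il']; rewrite [(l' <= j)%N]leq_eqVlt => /orP[/eqP->|lj].
      by rewrite eqxx ltnn /= qj; split=> //; case: cl.
    rewrite lj orbT.
    have [h1 h2] : (q l', q l'.+1, m l') \in h l' /\ (a <= m l')%N.
      by apply: qm; rewrite il' lj.
    by split=> //; apply: leq_trans h2; case: cl.
  have [ab|ba] := leqP a b.
    exists l; first by case/andP: lij => -> /= /leqW.
    by case/andP: lij => _ ->; rewrite ml cE /omin ab.
  exists j; first by rewrite ltnW/=.
  by rewrite ltnn cE /omin leqNgt ba.
move=> [q [m [<- <- qm [l lij ml]]]]; subst c.
elim: j ij l lij qm => // j IH; rewrite ltnS leq_eqVlt => /orP[/eqP<-|ij] l lij qm.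
  have li : l = i by apply/eqP; rewrite eqn_leq -ltnS andbC.
  by rewrite /segment big_nat1 li; have [] := qm i; rewrite ?leqnn/=.
rewrite (@segment_cat _ _ _ _ _ j)//; last exact: ltnW.
have [hj lj] : (q j, q j.+1, m j) \in h j /\ (m l <= m j)%N.
  by apply: qm; rewrite (ltnW ij) /=.
have [l' l'ij ml'] : exists2 l', (i <= l' < j)%N & forall k, (i <= k < j)%N -> (m l' <= m k)%N.
  have i0 : (i <= i < j)%N by rewrite leqnn.
  pose f (k : 'I_j) := m k; pose P (k : 'I_j) := (i <= k)%N.
  case: (@arg_minnP _ (Ordinal ij) P (fun k => m k : nat) (leqnn i)) => k Pk hk.
  exists k; first by rewrite ltn_ord andbT.
  by move=> k' /andP[ik' k'j]; exact: (hk (Ordinal k'j)).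
apply/profileMP; exists (q j), (m l'), (m j); split.
- apply: (IH ij l' l'ij) => k kij; split; last exact: ml'.
  by have [] := qm k => //; case/andP: kij => -> /= /leqW.
- by rewrite /segment big_nat1.
- have lm : (m l <= m l')%N by apply: (qm l' _).2; case/andP: l'ij => -> /= /leqW.
  rewrite /omin; move: lij; rewrite ltnS => /andP[il].
  rewrite leq_eqVlt => /orP[/eqP lE|lj'].
    have [e|] := leqP (m l') (m j); last by rewrite lE.
    by apply: val_inj; apply/eqP; rewrite eqn_leq lm lE.
  have e : (m l' <= m l)%N by apply: ml'; rewrite il.
  have -> : m l = m l' by apply: val_inj; apply/eqP; rewrite eqn_leq lm.
  by rewrite (leq_trans e).
Qed.

Lemma leq_blocks (K : nat -> nat) : (forall n, K n < K n.+1)%N ->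
  forall a b, (a <= b)%N -> (K a <= K b)%N.
Proof.
move=> KS a b /subnK <-; elim: (b - a)%N => // i; rewrite addSn => /leq_trans; apply.
exact: ltnW.
Qed.

Lemma block_exists (K : nat -> nat) : K 0%N = 0%N -> (forall n, K n < K n.+1)%N ->
  forall l, exists n, (K n <= l < K n.+1)%N.
Proof.
move=> K0 KS; elim=> [|l [n /andP[h1 h2]]].
  by exists 0%N; have := KS 0%N; rewrite K0.
have [e|e] := ltnP l.+1 (K n.+1); first by exists n; rewrite leqW.
exists n.+1; rewrite e /=; apply: leq_ltn_trans (KS _); exact: h2.
Qed.

Lemma block_unique (K : nat -> nat) l a b : (forall n, K n < K n.+1)%N ->
  (K a <= l < K a.+1)%N -> (K b <= l < K b.+1)%N -> a = b.
Proof.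
move=> KS /andP[a1 a2] /andP[b1 b2]; have mono := leq_blocks KS.
apply/eqP; rewrite eqn_leq -ltnS -[X in _ && X]ltnS.
apply/andP; split; rewrite ltnNge; apply/negP => /mono; rewrite leqNgt.
  by rewrite (leq_ltn_trans a1 b2).
by rewrite (leq_ltn_trans b1 a2).
Qed.

Lemma wins_blocks P (K : nat -> nat) (m m' : nat -> nat) : K 0%N = 0%N ->
  (forall n, K n < K n.+1)%N ->
  (forall n l, (K n <= l < K n.+1)%N -> (m' n <= m l)%N) ->
  (forall n, exists2 l, (K n <= l < K n.+1)%N & m l = m' n) ->
  wins P m <-> wins P m'.
Proof.
move=> K0 KS mle mex.
have Kge n : (n <= K n)%N by elim: n => // n IH; exact: leq_ltn_trans (KS n).
have Kmono := leq_blocks KS; have blk := block_exists K0 KS.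
split=> -[k [ok ik [n0 bk]]].
  exists k; split=> //; last first.
    exists n0 => n nn; have [l /andP[Kl _] <-] := mex n; apply: bk.
    exact: leq_trans (leq_trans nn (Kge _)) Kl.
  move=> n; have [l Kl ml] := ik (K (n + n0)%N); have [a al] := blk l.
  have na : (n + n0 <= a)%N.
    rewrite -ltnS ltnNge; apply/negP => /Kmono; rewrite leqNgt.
    by case/andP: al => _ /(leq_ltn_trans Kl) ->.
  exists a; first lia.
  apply/eqP; rewrite eqn_leq -{1}ml (mle _ _ al)/=.
  have [l' /andP[Kl' _] <-] := mex a; apply: bk.
  by apply: leq_trans Kl'; apply: leq_trans (Kge _); lia.
exists k; split=> //; last first.
  exists (K n0) => l Kl; have [a al] := blk l; apply: leq_trans (mle _ _ al).
  apply: bk; rewrite -ltnS ltnNge; apply/negP => /Kmono; rewrite leqNgt.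
  by case/andP: al => _ /(leq_ltn_trans Kl) ->.
move=> n; have [a na <-] := ik n; have [l /andP[al _] e] := mex a; exists l => //.
exact: leq_trans na (leq_trans (Kge _) al).
Qed.

Lemma has_run_blocks P I (K : nat -> nat) h : K 0%N = 0%N ->
  (forall n, K n < K n.+1)%N ->
  has_run P I h <-> has_run P I (fun n => segment profileM h (K n) (K n.+1)).
Proof.
move=> K0 KS; split=> [[q [m [Iq hq wm]]]|[q' [m' [Iq hq wm]]]].
  have /choice[m' m'P] n : exists c : 'I_d.+1,
      (forall l, (K n <= l < K n.+1)%N -> (c <= m l)%N) /\
      exists2 l, (K n <= l < K n.+1)%N & m l = c.
    pose P' (k : 'I_(K n.+1)) := (K n <= k)%N.
    case: (@arg_minnP _ (Ordinal (KS n)) P' (fun k => m k : nat) (leqnn _)) => k Pk hk.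
    exists (m k); split; last by exists k; rewrite ?ltn_ord ?andbT.
    by move=> l /andP[Kl lK]; exact: (hk (Ordinal lK)).
  exists (q \o K), m'; split=> /=; first by rewrite K0.
    move=> n; apply/segmentP => //; exists q, m; have [h1 h2] := m'P n; split=> //.
    by move=> l lK; split=> //; exact: h1.
  apply/(@wins_blocks _ K (fun n => m n) (fun n => m' n)) => //.
    by move=> n; have [+ _] := m'P n; exact.
  by move=> n; have [_ [l ? <-]] := m'P n; exists l.
have /choice[qm qmP] n := segmentP _ _ _ _ (KS n) (hq n).
have /choice[m mP] := qmP.
have /choice[b bP] := block_exists K0 KS.
have bE n l : (K n <= l < K n.+1)%N -> b l = n.
  by move=> h1; apply: block_unique (bP l) h1.
have KK n : (K n <= K n < K n.+1)%N by rewrite leqnn KS.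
exists (fun l => qm (b l) l), (fun l => m (b l) l); split.
- have e : b 0%N = 0%N.
    by apply: bE; rewrite K0 /=; have := KS 0%N; rewrite K0.
  by rewrite /= e; have [+ _ _ _] := mP 0%N; rewrite K0 => ->.
- move=> l; have lb := bP l; set n := b l in lb *.
  have [q1 q2 /(_ l lb)[+ _] _] := mP n.
  have [lt|ge] := ltnP l.+1 (K n.+1).
    by rewrite (bE n l.+1)//; case/andP: lb => /leqW ->.
  have e : l.+1 = K n.+1 by apply/eqP; rewrite eqn_leq ge andbT; case/andP: lb.
  by rewrite e (bE n.+1 (K n.+1))//; have [-> _ _ _] := mP n.+1; rewrite q2.
- apply/(@wins_blocks _ K (fun l => m (b l) l) (fun n => m' n)) => //.
    by move=> n l h1; rewrite (bE _ _ h1); have [_ _ /(_ l h1)[]] := mP n.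
  by move=> n; have [_ _ _ [l h1 h2]] := mP n; exists l => //; rewrite (bE _ _ h1) h2.
Qed.

Lemma has_run_factorization P I h s e : factorization profileM h s e ->
  has_run P I h <-> has_run P I (fun n => if n is 0 then s else e).
Proof.
move=> [J [J0 JS hs he]]; pose K n := if n is n'.+1 then J n' else 0%N.
have KS n : (K n < K n.+1)%N by case: n => //=.
rewrite (has_run_blocks P I h (erefl : K 0%N = 0%N) KS).
by rewrite (_ : (fun n => _) = (fun n => if n is 0 then s else e))//; apply/funext; case.
Qed.

Theorem word_determinization (I : Q -> Prop) :
  exists (D : finType) (D0 : D) (step : D -> {set Q * Q * 'I_d.+1} -> D) (pr : D -> nat),
    forall h r, r 0%N = D0 -> (forall n, r n.+1 = step (r n) (h n)) ->
      (wins false (pr \o r) <-> ~ has_run false I h).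
Proof.
pose S : finType := profile; pose N := #|S|.
pose acc (s e : S) := `[< ~ has_run false I (fun n => if n is 0 then s else e) >].
pose step (x : N.-bseq S * 'I_(N.+1.*2.+1)) (a : S) : N.-bseq S * 'I_(N.+1.*2.+1) :=
  (insub_bseq N (compress profileM x.1 a), inord (merge_prio profileM acc (rcons x.1 a))).
pose D0 : N.-bseq S * 'I_(N.+1.*2.+1) := ([bseq], ord0).
exists _, D0, step, (fun x => nat_of_ord x.2) => h r r0 rS.
have rE n : ((r n).1 : seq S) = state profileM h n.
  elim: n => [|n IH]; first by rewrite r0.
  by rewrite rS /= IH insubdK//; apply: size_compress; exact: size_state.
have pE n : ((r n.+1).2 : nat) = merge_prio profileM acc (rcons (state profileM h n) (h n)).
  rewrite rS /= rE inordK// ltnS; apply: merge_prio_le; exact: size_state.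
have W : wins (~~ `[< ~ has_run false I h >]) (fun n => (r n).2).
  apply: (@wins_shift _ _ 1).
  rewrite (_ : (fun n => _) =
      (fun n => merge_prio profileM acc (rcons (state profileM h n) (h n)))).
    apply: determinization_correct => s e fac.
    by apply: asbool_equiv_eq; exact: not_iff_compat (iff_sym (has_run_factorization _ _ fac)).
  by apply/funext => n; rewrite addn1 pE.
move: W; case: asboolP => [nhr W|hr W]; split=> //.
by move=> /(wins_exclusive W).
Qed.

End word_automata.
(** * Parity tree automata *)

Record automaton (A : Type) := Automaton {
  states : finType;
  choices : finType;
  choice0 : choices;
  initial : states -> Prop;
  delta : states -> A -> choices -> bool -> states;
  aprio : states -> nat
}.

Definition accepts A (M : automaton A) (t : vertex -> A) :=
  exists (c : vertex -> choices M) (rho : vertex -> states M),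
    [/\ initial (rho [::]),
        (forall w d, rho (rcons w d) = delta (rho w) (t w) (c w) d) &
        (forall b : word, wins false (fun n => aprio (rho (mkseq b n))))].

Lemma vertex_rec (T : Type) (x0 : T) (g : vertex -> T -> bool -> T) :
  exists r, r [::] = x0 /\ forall w d, r (rcons w d) = g w (r w) d.
Proof.
pose f := foldl (fun p d => (rcons p.1 d, g p.1 p.2 d)) ([::] : vertex, x0).
have f1 w : (f w).1 = w by elim/last_ind: w => // w d; rewrite /f foldl_rcons /= => ->.
exists (snd \o f); split=> // w d; rewrite /f /= foldl_rcons /= -/(f w) f1 //.
Qed.

Lemma branch_following (g : vertex -> bool) : exists b : word, forall n, b n = g (mkseq b n).
Proof.
have [r [r0 rS]] := @vertex_rec vertex [::] (fun _ w _ => rcons w (g w)).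
pose b : word := fun n => g (r (nseq n false)); exists b.
suff wE n : r (nseq n false) = mkseq b n by move=> n; rewrite -wE.
elim: n => [|n IH]; first exact: r0.
rewrite mkseqS -IH -addn1 nseqD cats1 rS //.
Qed.

Lemma wins_half P s : wins P (fun n => s n./2) -> wins P s.
Proof.
move=> [k [ok ik [n bk]]]; exists k; split=> //.
  by move=> m; have [i mi <-] := ik m.*2; exists i./2 => //; lia.
by exists n => m nm; rewrite -(doubleK m); apply: bk; lia.
Qed.

Section complement.
Variables (A : Type) (M : automaton A).
Let Q := states M.
Let F := choices M.

(* In the acceptance game the automaton (player [false]) picks a choice, then
   the pathfinder (player [true]) picks a direction. *)
Let position := (vertex * Q * option F)%type.
Let owner (v : position) := if v.2 is Some _ then true else false.
Let next (t : vertex -> A) (v : position) (f : F * bool) : position :=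
  if v.2 is Some c then (rcons v.1.1 f.2, delta v.1.2 (t v.1.1) c f.2, None)
  else (v.1, Some f.1).
Let prio (v : position) := aprio v.1.2.
Let d := (\max_(q : Q) aprio q)%N.

Let prio_le (q : Q) : (aprio q < d.+1)%N.
Proof. by rewrite ltnS; exact: (leq_bigmax q). Qed.

Let moves (a : A) (g : {ffun Q * F -> bool}) (e : bool) : {set Q * Q * 'I_d.+1} :=
  [set z : Q * Q * 'I_d.+1 | (z.2 == aprio z.1.1 :> nat) &&
     [exists f, (g (z.1.1, f) == e) && (z.1.2 == delta z.1.1 a f e)]].

Let letter (t : vertex -> A) (g : vertex -> {ffun Q * F -> bool}) (b : word) n :=
  moves (t (mkseq b n)) (g (mkseq b n)) (b n).

Let letterP (t : vertex -> A) (g : vertex -> {ffun Q * F -> bool}) b n (q q' : Q) (m : 'I_d.+1) :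
  reflect (m = aprio q :> nat /\ exists f,
    g (mkseq b n) (q, f) = b n /\ q' = delta q (t (mkseq b n)) f (b n))
  ((q, q', m) \in letter t g b n).
Proof.
rewrite inE /=; apply: (iffP andP) => [[/eqP h1 /existsP[f /andP[/eqP h2 /eqP h3]]]|].
  by split=> //; exists f.
by move=> [-> [f [h2 h3]]]; split=> //; apply/existsP; exists f; rewrite h2 -h3 !eqxx.
Qed.

Lemma not_acceptsP t : ~ accepts M t <->
  exists g, forall b, ~ has_run false (@initial _ M) (letter t g b).
Proof.
split=> [nacc|[g hg] [c [rho [i0 rhoS W]]]]; last first.
  have [b bE] := branch_following (fun w => g w (rho w, c w)).
  apply: (hg b); exists (fun n => rho (mkseq b n)).
  exists (fun n => inord (aprio (rho (mkseq b n)))); split=> //.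
    move=> n; apply/letterP; split; first by rewrite inordK.
    exists (c (mkseq b n)); by rewrite mkseqS rhoS bE.
  rewrite (_ : (fun n => _) = (fun n => aprio (rho (mkseq b n))))//.
  by apply/funext => n; rewrite inordK.
have [|v _|W0 [W1 [sg0 [sg1 [r0 r1 c]]]]] :=
    @positional_determinacy position (F * bool)%type (choice0 M, false)
      owner (next t) prio d.+1 0 setT.
- by move=> v _; exists (choice0 M, false).
- by rewrite /= add0n; exact: prio_le.
have W1q q : initial q -> W1 ([::], q, None).
  move=> iq; have [|//] := c ([::], q, None) I => W0q; case: nacc.
  have [rho [rho0 rhoS]] := @vertex_rec Q q
    (fun w q => delta q (t w) (sg0 (w, q, None)).1).
  exists (fun w => (sg0 (w, rho w, None)).1), rho; split; rewrite ?rho0// => b.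
  pose p n : position := let w := mkseq b n./2 in
    (w, rho w, if odd n then Some (sg0 (w, rho w, None)).1 else None).
  have pS n : p n.+1 = if odd n then next t (p n) (choice0 M, b n./2)
                       else next t (p n) (sg0 (p n)).
    rewrite /p /next /= uphalf_half; case: (odd n) => //=.
    by rewrite add1n mkseqS rhoS.
  have [_ cP cO win] := r0.
  have Wp n : W0 (p n).
    elim: n => [|n IH]; first by rewrite /p /= rho0.
    rewrite pS; case on: (odd n); last by apply: cP => //; rewrite /p /owner /= on.
    by apply: cO => //; rewrite /p /owner /= on.
  apply: wins_half; apply: (win p) => // n.
  rewrite pS; case on: (odd n); last by rewrite {1}/p /owner /= on.
  by rewrite {1}/p /owner /= on /=; eexists.
pose g w : {ffun Q * F -> bool} := [ffun qf => (sg1 (w, qf.1, Some qf.2)).2].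
exists g => b [q [m [/W1q i0 hq W]]].
have /choice[f fP] n : exists f, g (mkseq b n) (q n, f) = b n /\
    q n.+1 = delta (q n) (t (mkseq b n)) f (b n).
  by have /letterP[_ [f hf]] := hq n; exists f.
pose p n : position := let w := mkseq b n./2 in
  (w, q n./2, if odd n then Some (f n./2) else None).
have pS n : p n.+1 = if odd n then next t (p n) (sg1 (p n)) 
                     else next t (p n) (f n./2, false).
  rewrite /p /next /= uphalf_half; case: (odd n) => //=.
  rewrite add1n mkseqS; have [+ ->] := fP n./2.
  by rewrite ffunE /= => ->.
have [_ cP cO win] := r1.
have Wp n : W1 (p n).
  elim: n => [|n IH]; first by [].
  rewrite pS; case on: (odd n); first by apply: cP => //; rewrite /p /owner /= on.
  by apply: cO => //; rewrite /p /owner /= on.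
apply: (@wins_exclusive (fun n => aprio (q n))).
  apply: wins_half; apply: (win p) => // n.
  rewrite pS; case on: (odd n); first by rewrite {1}/p /owner /= on.
  by rewrite {1}/p /owner /= on /=; eexists.
rewrite (_ : (fun n => _) = (fun n => m n : nat))//.
by apply/funext => n; have /letterP[->] := hq n.
Qed.

Theorem complement_automaton : exists M' : automaton A,
  forall t, accepts M' t <-> ~ accepts M t.
Proof.
have [D [D0 [step [pr H]]]] := word_determinization d (@initial _ M).
pose del (s : D) (a : A) (g : {ffun Q * F -> bool}) (e : bool) : D :=
  step s (moves a g e).
pose M' := @Automaton A D {ffun Q * F -> bool} [ffun=> false] (fun s => s = D0) del pr.
exists M' => t; rewrite not_acceptsP; split.
  move=> [g [rho [r0 rS W]]]; exists g => b.
  apply/(H (letter t g b) (fun n => rho (mkseq b n))) => //; last exact: W.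
  by move=> n; rewrite mkseqS rS.
move=> [g hg].
have [rho [r0 rS]] := @vertex_rec D D0 (fun w s e => del s (t w) (g w) e).
exists g, rho; split=> // b.
apply/(H (letter t g b) (fun n => rho (mkseq b n))) => //.
by move=> n; rewrite mkseqS rS.
Qed.

End complement.

(** * Translation of S2S *)

Definition labels (E : nat -> set vertex) (w : vertex) (n : nat) := `[< E n w >].

Definition regular (P : (nat -> set vertex) -> Prop) :=
  exists M : automaton (nat -> bool), forall E, accepts M (labels E) <-> P E.

Lemma regular_ext P P' : (forall E, P E <-> P' E) -> regular P -> regular P'.
Proof. by move=> e [M h]; exists M => E; rewrite h. Qed.

Lemma regular_not P : regular P -> regular (fun E => ~ P E).
Proof.
move=> [M h]; have [M' h'] := complement_automaton M; exists M' => E.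
by rewrite h'; apply: not_iff_compat.
Qed.

Lemma regular_or P P' : regular P -> regular P' -> regular (fun E => P E \/ P' E).
Proof.
move=> [M h] [M' h'].
pose N := @Automaton (nat -> bool) (states M + states M')%type (choices M * choices M')%type
  (choice0 M, choice0 M')
  (fun s => match s with inl q => initial q | inr q => initial q end)
  (fun s a f d => match s with inl q => inl (delta q a f.1 d)
                             | inr q => inr (delta q a f.2 d) end)
  (fun s => match s with inl q => aprio q | inr q => aprio q end).
exists N => E; rewrite -h -h'; split.
  move=> [c [rho [i0 rS W]]]; case e0 : (rho [::]) i0 => [q0|q0] i0.
    pose r w := if rho w is inl q then q else q0.
    have rE w : rho w = inl (r w).
      elim/last_ind: w => [|w d IH]; first by rewrite /r e0.
      by rewrite /r rS IH.
    left; exists (fst \o c), r; split; first by rewrite /r e0.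
      by move=> w d; rewrite {1}/r rS rE.
    by move=> b; have := W b; under eq_fun do rewrite rE.
  pose r w := if rho w is inr q then q else q0.
  have rE w : rho w = inr (r w).
    elim/last_ind: w => [|w d IH]; first by rewrite /r e0.
    by rewrite /r rS IH.
  right; exists (snd \o c), r; split; first by rewrite /r e0.
    by move=> w d; rewrite {1}/r rS rE.
  by move=> b; have := W b; under eq_fun do rewrite rE.
case=> -[c [rho [i0 rS W]]].
  exists (fun w => (c w, choice0 M')), (fun w => inl (rho w)); split=> // w d.
  by rewrite rS.
exists (fun w => (choice0 M, c w)), (fun w => inr (rho w)); split=> // w d.
by rewrite rS.
Qed.

Lemma regular_ex n P : regular P -> regular (fun E => exists B, P [eta E with n |-> B]).
Proof.
move=> [M h].
pose N := @Automaton (nat -> bool) (states M) (choices M * bool)%type (choice0 M, false)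
  (@initial _ M) (fun s a f d => delta s [eta a with n |-> f.2] f.1 d) (@aprio _ M).
have lE E B w : labels [eta E with n |-> B] w = [eta labels E w with n |-> `[< B w >]].
  by apply/funext => i; rewrite /labels /=; case: eqP.
exists N => E; split=> [[c [rho [i0 rS W]]]|[B /h[c [rho [i0 rS W]]]]].
  exists [set w | (c w).2]; apply/h; exists (fst \o c), rho; split=> // w d.
  by rewrite rS lE /= asboolb.
exists (fun w => (c w, `[< B w >])), rho; split=> // w d.
by rewrite rS lE.
Qed.

Lemma regular_all n P : regular P -> regular (fun E => forall B, P [eta E with n |-> B]).
Proof.
move=> /regular_not/(regular_ex n)/regular_not; apply: regular_ext => E.
by split=> [h B|h [B]]; [apply: contrapT => nP; apply: h; exists B|apply].
Qed.

Lemma regular_imp P P' : regular P -> regular P' -> regular (fun E => P E -> P' E).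
Proof.
move=> /regular_not h h'; apply: regular_ext (regular_or h h') => E.
by split=> [[//|]|]; [|case: (pselect (P E)); auto].
Qed.

Lemma regular_and P P' : regular P -> regular P' -> regular (fun E => P E /\ P' E).
Proof.
move=> h /regular_not h'; have := regular_not (regular_imp h h').
by apply: regular_ext => E; split=> [/not_implyP[? /contrapT]|[p p'] /(_ p)].
Qed.

Lemma wins_const P k : odd k = P -> wins P (fun=> k).
Proof. by move=> ok; exists k; split=> //; [move=> n; exists n|exists 0%N]. Qed.

(* [up] computes from the label of the parent what has to be remembered at a
   vertex. *)
Lemma regular_local (T : finType) (m0 : T) (up : (nat -> bool) -> bool -> T)
    (ok : T -> (nat -> bool) -> bool) (mem : (nat -> set vertex) -> vertex -> T) :
  (forall E, mem E [::] = m0) ->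
  (forall E w d, mem E (rcons w d) = up (labels E w) d) ->
  regular (fun E => forall w, ok (mem E w) (labels E w)).
Proof.
move=> mem0 memS.
pose M := @Automaton (nat -> bool) (option T) unit tt (fun s => s = Some m0)
  (fun s a _ d => if s is Some m then if ok m a then Some (up a d) else None else None)
  (fun s => if s is Some _ then 0%N else 1%N).
exists M => E; split=> [[c [rho [i0 rS W]]] w|h]; last first.
  exists (fun=> tt), (fun w => Some (mem E w)); split=> /=; rewrite ?mem0//.
    by move=> w d; rewrite h memS.
  by move=> b; exact: wins_const.
have fail v : rho v <> None.
  move=> rv; pose b n := nth false v n.
  have vb : mkseq b (size v) = v by exact: mkseq_nth.
  apply: (wins_exclusive _ (W b)); apply: (@wins_shift _ _ (size v)).
  rewrite (_ : (fun n => _) = fun=> 1%N); first exact: wins_const.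
  apply/funext => n; rewrite (_ : rho _ = None)//.
  elim: n => [|n IH]; first by rewrite add0n vb.
  by rewrite addSn mkseqS rS IH.
have rE v : rho v = Some (mem E v).
  elim/last_ind: v => [|v d IH]; first by rewrite i0 mem0.
  by have := @fail (rcons v d); rewrite rS IH /= memS; case: ifP.
by have := @fail (rcons w true); rewrite rS rE /=; case: ifP.
Qed.

Lemma regular_subset n k : regular (fun E => E n `<=` E k).
Proof.
have := @regular_local unit tt (fun _ _ => tt) (fun _ a => a n ==> a k) (fun _ _ => tt).
move=> /(_ (fun=> erefl) (fun _ _ _ => erefl)); apply: regular_ext => E.
split=> h w; last by apply/implyP => /asboolP/h/asboolP.
by move=> En; apply/asboolP; move/implyP: (h w); apply; exact/asboolP.
Qed.

Lemma regular_child n k d : regular (fun E => forall w, E n w -> E k (rcons w d)).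
Proof.
pose mem E w := if rev w is e :: u then (e == d) && labels E (rev u) n else false.
have := @regular_local bool false (fun a e => (e == d) && a n) (fun m a => m ==> a k) mem.
have memS E w e : mem E (rcons w e) = (e == d) && labels E w n.
  by rewrite /mem rev_rcons revK.
move=> /(_ (fun=> erefl) memS); apply: regular_ext => E.
split=> [h w|h].
  by have := h (rcons w d); rewrite memS eqxx => /implyP h' /asboolP/h'/asboolP.
elim/last_ind=> [|w e _]; first by rewrite /mem.
by rewrite memS; apply/implyP => /andP[/eqP-> /asboolP/h/asboolP].
Qed.

Lemma regular_empty n : regular (fun E => E n = set0).
Proof.
have := @regular_all n.+1 _ (regular_subset n n.+1); apply: regular_ext => E.
rewrite /= eqxx (ltn_eqF (ltnSn n)).
by split=> [/(_ set0)|-> B]; [rewrite subset0|].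
Qed.

Lemma regular_singleton n : regular (fun E => exists v, E n = [set v]).
Proof.
have := regular_and (regular_not (regular_empty n))
  (@regular_all n.+1 _ (regular_imp (regular_subset n.+1 n)
     (regular_or (regular_empty n.+1) (regular_subset n n.+1)))).
apply: regular_ext => E /=; rewrite eqxx (ltn_eqF (ltnSn n)).
split=> [[/eqP/set0P[v Ev] /(_ [set v])]|[v ->]].
  case=> [_ -> //|e|e]; last by exists v; apply/seteqP; split=> // _ ->.
  by have : [set v] v by []; rewrite e.
split; first by move=> e; have : [set v] v by []; rewrite e.
move=> B Bv; have [->|/set0P[u Bu]] := eqVneq B set0; first by left.
by right=> _ ->; rewrite -(Bv _ Bu).
Qed.

Lemma sat_regular (R : realType) phi : is_S2S phi -> exists P, regular P /\
  forall E e1 e2, {in fv1 phi, forall x, E x.*2 = [set e1 x]} ->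
    {in fv2 phi, forall X, E X.*2.+1 = e2 X} -> sat R phi e1 e2 <-> P E.
Proof.
have upd1 (s : seq nat) x E (e1 : nat -> vertex) (v : vertex) :
    {in [seq y <- s | y != x], forall y, E y.*2 = [set e1 y]} ->
    {in s, forall y, [eta E with x.*2 |-> [set v]] y.*2 = [set [eta e1 with x |-> v] y]}.
  move=> h y ys /=; rewrite -!muln2 eqn_pmul2r//; case: eqVneq => // yx.
  by rewrite muln2; apply: h; rewrite mem_filter yx.
have upd2 (s : seq nat) x E (e2 : nat -> set vertex) B :
    {in [seq y <- s | y != x], forall y, E y.*2.+1 = e2 y} ->
    {in s, forall y, [eta E with x.*2.+1 |-> B] y.*2.+1 = [eta e2 with x |-> B] y}.
  move=> h y ys /=; rewrite eqSS -!muln2 eqn_pmul2r//; case: eqVneq => // yx.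
  by rewrite muln2; apply: h; rewrite mem_filter yx.
have old1 (s : seq nat) x E (e1 : nat -> vertex) B :
    {in s, forall y, E y.*2 = [set e1 y]} ->
    {in s, forall y, [eta E with x.*2.+1 |-> B] y.*2 = [set e1 y]}.
  by move=> h y ys /=; case: eqP => [|_]; [lia|exact: h].
have old2 (s : seq nat) x E (e2 : nat -> set vertex) B :
    {in s, forall y, E y.*2.+1 = e2 y} ->
    {in s, forall y, [eta E with x.*2 |-> B] y.*2.+1 = e2 y}.
  by move=> h y ys /=; case: eqP => [|_]; [lia|exact: h].
elim: phi => [x y|x y|x X|phi IH|phi IH psi IH'|x phi IH|X phi IH|//] /=.
- move=> _; eexists; split; first exact: (regular_child x.*2 y.*2 dirL).
  move=> E e1 e2 h _ /=; rewrite !h ?inE ?eqxx ?orbT//.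
  by split=> [-> _ ->|/(_ (e1 x) erefl)].
- move=> _; eexists; split; first exact: (regular_child x.*2 y.*2 dirR).
  move=> E e1 e2 h _ /=; rewrite !h ?inE ?eqxx ?orbT//.
  by split=> [-> _ ->|/(_ (e1 x) erefl)].
- move=> _; eexists; split; first exact: (regular_subset x.*2 X.*2.+1).
  move=> E e1 e2 h h' /=; rewrite h ?h' ?inE//.
  by split=> [? _ ->|/(_ (e1 x) erefl)].
- move=> /IH[P [rP h]]; exists (fun E => ~ P E); split; first exact: regular_not.
  by move=> E e1 e2 h1 h2; apply: not_iff_compat; exact: h.
- move=> /andP[/IH[P [rP h]] /IH'[P' [rP' h']]].
  exists (fun E => P E \/ P' E); split; first exact: regular_or.
  move=> E e1 e2 h1 h2; rewrite (h E e1 e2) ?(h' E e1 e2)//.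
  + by move=> z zP; apply: h1; rewrite mem_cat zP orbT.
  + by move=> z zP; apply: h2; rewrite mem_cat zP orbT.
  + by move=> z zP; apply: h1; rewrite mem_cat zP.
  + by move=> z zP; apply: h2; rewrite mem_cat zP.
- move=> /IH[P [rP h]].
  have := regular_all x.*2 (regular_imp (regular_singleton x.*2) rP); set P' := fun E => _.
  move=> rP'; exists P'; split=> // E e1 e2 h1 h2; rewrite /P' /= eqxx; split=> [hs B [v ->]|hP v].
    by apply/(h _ [eta e1 with x |-> v] e2); [exact: upd1|exact: old2|exact: hs].
  by apply/(h [eta E with x.*2 |-> [set v]]); [exact: upd1|exact: old2|apply: hP; exists v].
- move=> /IH[P [rP h]]; have := regular_all X.*2.+1 rP; set P' := fun E => _.
  move=> rP'; exists P'; split=> // E e1 e2 h1 h2; split=> hs B.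
    by apply/(h _ e1 [eta e2 with X |-> B]); [exact: old1|exact: upd2|exact: hs].
  by apply/(h [eta E with X.*2.+1 |-> B]); [exact: old1|exact: upd2|exact: hs].
Qed.

(** * Regular trees *)

Section basis.
Variables (A : Type) (L : finType) (M : automaton A) (e : L -> A).
Let Q := states M.
Let F := choices M.

(* In the emptiness game the automaton also picks the label of the tree. *)
Let position := (Q * option (L * F))%type.
Let owner (v : position) := if v.2 is Some _ then true else false.
Let next (v : position) (f : L * F * bool) : position :=
  if v.2 is Some c then (delta v.1 (e c.1) c.2 f.2, None) else (v.1, Some f.1).
Let prio (v : position) := aprio v.1.

Theorem regular_tree_basis t : accepts M (e \o t) ->
  exists (rho : vertex -> Q) (step : Q -> bool -> Q) (beta : Q -> L),
    (forall w d, rho (rcons w d) = step (rho w) d) /\ accepts M (e \o beta \o rho).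
Proof.
move=> [c [rho [i0 rS W]]].
have f0 : L * F * bool := (t [::], choice0 M, false).
pose d := (\max_(q : Q) aprio q)%N.
have prio_le (v : position) : (prio v < d.+1)%N by rewrite ltnS; exact: (leq_bigmax v.1).
have [|v _|W0 [W1 [sg0 [sg1 [r0 r1 cov]]]]] :=
    @positional_determinacy position (L * F * bool)%type f0 owner next prio d.+1 0 setT.
- by move=> v _; exists f0.
- by rewrite /= add0n; exact: prio_le.
have [W0q|W1q] := cov (rho [::], None) I; last first.
  have [b bE] := branch_following (fun w => (sg1 (rho w, Some (t w, c w))).2).
  pose p n : position := let w := mkseq b n./2 in
    (rho w, if odd n then Some (t w, c w) else None).
  have pS n : p n.+1 = if odd n then next (p n) (sg1 (p n))
      else next (p n) (t (mkseq b n./2), c (mkseq b n./2), false).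
    rewrite /p /next /= uphalf_half; case: (odd n) => //=.
    by rewrite add1n mkseqS rS -bE.
  have [_ cP cO win] := r1.
  have Wp n : W1 (p n).
    elim: n => [//|n IH].
    rewrite pS; case on: (odd n); first by apply: cP => //; rewrite /p /owner /= on.
    by apply: cO => //; rewrite /p /owner /= on.
  case: (wins_exclusive _ (W b)).
  apply: wins_half; apply: (win p) => // n.
  rewrite pS; case on: (odd n); first by rewrite {1}/p /owner /= on.
  by rewrite {1}/p /owner /= on /=; eexists.
pose beta q := (sg0 (q, None)).1.1; pose phi q := (sg0 (q, None)).1.2.
pose step q x := delta q (e (beta q)) (phi q) x.
have [r [r00 rrS]] := @vertex_rec Q (rho [::]) (fun _ => step).
exists r, step, beta; split=> //; exists (phi \o r), r; split=> //; first by rewrite r00.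
move=> b; pose p n : position := let w := mkseq b n./2 in
  (r w, if odd n then (Some (beta (r w), phi (r w))) else None).
have pS n : p n.+1 = if odd n then next (p n) (f0.1, b n./2)
    else next (p n) (sg0 (p n)).
  rewrite /p /next /= uphalf_half; case: (odd n) => //=.
    by rewrite add1n mkseqS rrS.
  by rewrite -surjective_pairing.
have [_ cP cO win] := r0.
have Wp n : W0 (p n).
  elim: n => [|n IH]; first by rewrite /p /= r00.
  rewrite pS; case on: (odd n); last by apply: cP => //; rewrite /p /owner /= on.
  by apply: cO => //; rewrite /p /owner /= on.
apply: wins_half; apply: (win p) => // n.
rewrite pS; case on: (odd n); last by rewrite {1}/p /owner /= on.
by rewrite {1}/p /owner /= on /=; eexists.
Qed.

End basis.

(** * Almost every path *)

Definition meeting (A : set vertex) : set (set vertex) :=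
  [set p | is_path p /\ exists v, p v /\ A v].

Definition dense (A : set vertex) := forall w, exists u, A (w ++ u).

Section measure_of_dense_sets.
Local Open Scope ring_scope.
Variable R : realType.

Lemma measurable_cylinder s : measurable (cylinder s : set measurable_word).
Proof. by apply: sub_sigma_algebra; exists s. Qed.

(* The k-th vertex is extended by a word long enough that the cylinders of all
   these extensions have total measure at most 1/2. *)
Lemma exists_dense_not_met : exists A, dense A /\ ~ path_measure_one R (meeting A).
Proof.
pose ext k (u : vertex) := u ++ nseq k.+2 false.
exists [set w | exists k u, unpickle k = Some u /\ w = ext k u]; split.
  by move=> w; exists (nseq (pickle w).+2 false), (pickle w), w; rewrite pickleK.
move=> [B [mB BA B1]].
pose C k : set measurable_word := if unpickle k is Some u then cylinder (ext k u) else set0.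
have mC k : measurable (C k).
  by rewrite /C; case: unpickle => [u|]//; exact: measurable_cylinder.
have BC : B `<=` \bigcup_k C k.
  move=> b /BA[_ [w [bw [k [u [ku we]]]]]]; exists k => //.
  by rewrite /C ku /cylinder/= -we -bw.
suff : (mu_w R B < 1)%E by rewrite B1 ltxx.
apply: le_lt_trans (measure_sigma_subadditive (mu_w R) mC mB BC) _.
apply: (@le_lt_trans _ _ (2^-1)%:E); last by rewrite lte_fin; lra.
apply: le_trans (epsilon_trick0 xpredT _); last by rewrite invr_ge0.
apply: lee_nneseries => // k _; rewrite /C; case: unpickle => [u|]; last first.
  by rewrite measure0 lee_fin divr_ge0// invr_ge0.
rewrite [X in (X <= _)%E](mu_w_cylinder R (ext k u)) lee_fin size_cat size_nseq exprD invfM natrX.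
rewrite (exprS _ k.+1) [(2 * _)^-1]invfM.
rewrite ler_piMl ?mulr_ge0 ?invr_ge0 ?exprn_ge0//.
by rewrite invf_le1 ?exprn_gt0// exprn_ege1// ler1n.
Qed.

Lemma uniformly_dense_met (A : set vertex) N :
  (forall w, exists2 u, (size u <= N)%N & A (w ++ u)) -> path_measure_one R (meeting A).
Proof.
move=> dA; pose C k : set measurable_word :=
  if unpickle k is Some u then (if `[< A u >] then cylinder u else set0) else set0.
pose B := \bigcup_k C k.
have mB : measurable B.
  apply: bigcupT_measurable => k; rewrite /C; case: unpickle => [u|]//.
  by case: ifP => // _; exact: measurable_cylinder.
have AB u : A u -> cylinder u `<=` B.
  by move=> Au b bu; exists (pickle u) => //; rewrite /C pickleK asboolT.
have mD w : measurable (cylinder w `\` B : set measurable_word).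
  by apply: measurableD => //; exact: measurable_cylinder.
pose r : R := 1 - 2^-1 ^+ N.
have step rho : 0 <= rho ->
    (forall w, (mu_w R (cylinder w `\` B) <= (2^-1 ^+ size w * rho)%:E)%E) ->
    forall u w, A (w ++ u) ->
    (mu_w R (cylinder w `\` B) <= (2^-1 ^+ size w * (rho * (1 - 2^-1 ^+ size u)))%:E)%E.
  move=> rho0 h; elim=> [|e u IH] w.
    rewrite cats0 => /AB wB; have -> : cylinder w `\` B = set0 by rewrite setD_eq0.
    by rewrite measure0 expr0 subrr !mulr0.
  rewrite -cat_rcons => /IH h1.
  have -> : cylinder w `\` B = (cylinder (rcons w e) `\` B) `|` (cylinder (rcons w (~~ e)) `\` B).
    rewrite -setDUl; congr (_ `\` _); rewrite !cylinder_rcons -setIUr.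
    rewrite (_ : _ `|` _ = setT) ?setIT//; apply/seteqP; split=> // b _ /=.
    by case: (b _); case: e {h1}; [left|right|right|left].
  apply: le_trans (measureU2 _ (mD _) (mD _)) _.
  apply: le_trans (leeD h1 (h (rcons w (~~ e)))) _.
  rewrite -EFinD lee_fin !size_rcons /= !exprS.
  by rewrite le_eqVlt; apply/orP; left; apply/eqP; field.
have r01 : 0 <= r < 1.
  have h0 : 0 < 2^-1 ^+ N :> R by rewrite exprn_gt0// invr_gt0.
  have h1 : 2^-1 ^+ N <= 1 :> R by rewrite exprn_ile1//; lra.
  by rewrite /r; lra.
have r0 m : 0 <= r ^+ m by rewrite exprn_ge0//; case/andP: r01.
have bound m w : (mu_w R (cylinder w `\` B) <= (2^-1 ^+ size w * r ^+ m)%:E)%E.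
  elim: m w => [|m IH] w.
    rewrite expr0 mulr1 exprVn -mu_w_cylinder; apply: le_measure; rewrite ?inE//.
      exact: measurable_cylinder.
  have [u uN Au] := dA w; apply: le_trans (step _ (r0 m) IH u w Au) _.
  rewrite lee_fin ler_wpM2l ?exprn_ge0// exprSr ler_wpM2l// lerB//.
  by rewrite ler_wiXn2l//; lra.
exists B; split=> //.
  move=> b [k _]; rewrite /C; case: unpickle => [u|]//; case: asboolP => // Au bu.
  split; first by have [pf _ _] := path_of_bij; exact: (pf b I).
  by exists u; split=> //; rewrite /path_of /= bu.
have mCB : measurable (~` B : set measurable_word) by exact: measurableC.
have B0 : mu_w R (~` B) = 0%E.
  apply/eqP; rewrite eq_le measure_ge0 andbT.
  have x m : (mu_w R (~` B) <= (r ^+ m)%:E)%E.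
    have := bound m [::]; rewrite expr0 mul1r.
    by rewrite (_ : cylinder [::] = setT) ?setTD//; apply/seteqP; split.
  rewrite leNgt; apply/negP => x0.
  have xf : mu_w R (~` B) \is a fin_num by exact: fin_num_measure.
  move: x0 x; rewrite -(fineK xf) lte_fin; set y := fine _ => y0 x.
  have /cvgr0Pnorm_lt/(_ _ y0)[m _ /(_ m (leqnn m))] : GRing.exp r @ \oo --> (0 : R).
    by apply: cvg_expr; rewrite ger0_norm; lra.
  by rewrite /= ger0_norm// ltNge -lee_fin x.
by have := probability_setC (mu_w R) mCB; rewrite setCK B0 sube0.
Qed.

End measure_of_dense_sets.

(** * Separation *)

Definition meets_formula := Neg (All1 0 (Or (Neg (Mem 0 1)) (Neg (Mem 0 0)))).

(* Every nonempty set of vertices closed under children meets the set 0. *)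
Definition dense_formula := All2 1 (Or (Or
  (Neg (All1 0 (All1 1 (Or (Or (Neg (Mem 0 1)) (Mem 1 1)) (Neg (Or (SuccL 0 1) (SuccR 0 1)))))))
  (All1 0 (Neg (Mem 0 1)))) meets_formula).

Definition separating_formula := Neg (Or (AllPath1 1 meets_formula) (Neg dense_formula)).

Lemma sat_meets (R : realType) e1 e2 :
  sat R meets_formula e1 e2 <-> exists v, e2 1%N v /\ e2 0%N v.
Proof.
split=> [/=/existsNP[v /not_orP[/contrapT h /contrapT h']]|[v [h h']] /= /(_ v)].
  by exists v.
by case; apply.
Qed.

Lemma sat_dense (R : realType) e1 e2 : sat R dense_formula e1 e2 <-> dense (e2 0%N).
Proof.
split=> [h w|h Z].
  pose Z := [set v | exists u, v = w ++ u].
  case: (h Z) => [[h'|h']|h']; last first.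
  - by have [v [/= [u ->] Av]] := (sat_meets R e1 [eta e2 with 1%N |-> Z]).1 h'; exists u.
  - by case: (h' w); exists [::]; rewrite cats0.
  - case: h' => v v' /=; have [[u ->]|nv] := pselect (exists u, v = w ++ u); last by left; left.
    have [[e ->]|nv'] := pselect (exists e, v' = rcons (w ++ u) e).
      by left; right; exists (rcons u e); rewrite rcons_cat.
    by right=> -[] e; apply: nv'; [exists dirL|exists dirR].
have [[v Zv]|nZ] := pselect (exists v, Z v); last first.
  by left; right=> v /= Zv; apply: nZ; exists v.
have [cZ|ncZ] := pselect (forall u e, Z u -> Z (rcons u e)); last first.
  left; left=> /= h'; apply: ncZ => u e Zu; case: (h' u (rcons u e)) => [[//|//]|].
  by case: e; case; [right|left].
have [u Au] := h v; right; apply/(sat_meets R e1 [eta e2 with 1%N |-> Z]) => /=.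
exists (v ++ u); split=> //.
by elim/last_ind: u {Au} => [|u e IH]; rewrite ?cats0// -rcons_cat; exact: cZ.
Qed.

Lemma sat_separating (R : realType) e1 e2 : sat R separating_formula e1 e2 <->
  dense (e2 0%N) /\ ~ path_measure_one R (meeting (e2 0%N)).
Proof.
rewrite -(sat_dense R e1 e2) /meeting.
have -> : [set p | is_path p /\ exists v, p v /\ e2 0%N v] =
    [set p | is_path p /\ sat R meets_formula e1 [eta e2 with 1%N |-> p]].
  by apply/seteqP; split=> p [pp h]; split=> //;
    apply/(sat_meets R e1 [eta e2 with 1%N |-> p]).
split=> [/not_orP[h /contrapT]//|[h1 h2] []//].
Qed.

Lemma regular_dense_met (R : realType) (Q : finType) (rho : vertex -> Q)
    (step : Q -> bool -> Q) (beta : Q -> bool) :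
  (forall w d, rho (rcons w d) = step (rho w) d) ->
  dense [set w | beta (rho w)] -> path_measure_one R (meeting [set w | beta (rho w)]).
Proof.
move=> rS dA.
have rcat w w' u : rho w = rho w' -> rho (w ++ u) = rho (w' ++ u).
  move=> e; elim/last_ind: u => [|u d IH]; first by rewrite !cats0.
  by rewrite -!rcons_cat !rS IH.
have /choice[u uP] q : exists u, forall w, rho w = q -> beta (rho (w ++ u)).
  have [[w wq]|nq] := pselect (exists w, rho w = q); last first.
    by exists [::] => w wq; case: nq; exists w.
  by have [u Au] := dA w; exists u => w' w'q; rewrite (rcat _ w) ?w'q.
apply: (@uniformly_dense_met _ _ (\max_q size (u q))) => w.
exists (u (rho w)); first exact: (leq_bigmax (rho w)).
exact: uP.
Qed.

Theorem theorem9p4 (R : realType) :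
  (forall (n : nat) (S : set ('I_n -> set vertex)),
     S2S_definable R S -> S2S_path_definable R S) /\
  (exists (n : nat) (S : set ('I_n -> set vertex)),
     S2S_path_definable R S /\ ~ S2S_definable R S).
Proof.
split=> [n S [phi [_ dphi]]|]; first by exists phi.
exists 1%N, [set t | sat R separating_formula (fun=> [::]) (tuple_env t)]; split.
  by exists separating_formula; split=> // X; rewrite !inE orbb => /eqP ->.
move=> [phi [phiS [fv1phi fv2phi Sphi]]].
have [P [[M MP] hP]] := sat_regular R phiS.
have t0 A : tuple_env (fun _ : 'I_1 => A) 0 = A by rewrite /tuple_env insubT.
pose env A i : set vertex := if i == 1%N then A else set0.
have MA A : accepts M (labels (env A)) <->
    dense A /\ ~ path_measure_one R (meeting A).
  rewrite MP -(hP _ (fun=> [::]) (tuple_env (fun _ : 'I_1 => A))).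
  - by have := congr1 (fun S : set _ => S (fun=> A)) Sphi; rewrite /mkset => <-;
      rewrite sat_separating t0.
  - by rewrite fv1phi.
  - by move=> X /fv2phi; rewrite ltnS leqn0 => /eqP ->; rewrite t0.
pose e (l : bool) (i : nat) := if i == 1%N then l else false.
have eE A : labels (env A) = e \o (fun w => `[< A w >]).
  apply/funext => w; apply/funext => i; rewrite /labels /env /e /=.
  by case: eqP => // _; rewrite asboolF.
have [A0 /MA] := exists_dense_not_met R; rewrite eE => /regular_tree_basis.
move=> [rho [step [beta [rS acc]]]].
have [] := (MA [set w | beta (rho w)]).1.
  rewrite eE; move: acc; congr accepts; apply/funext => w /=.
  by rewrite asboolb.
by move=> dA; apply; exact: regular_dense_met rS dA.
Qed.
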